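(* Let $\tilde P_n=\{\mathbf U_1,\dots,\mathbf U_n\}\subseteq[0,1)^s$, $n=b^m$, be a scrambled $(t,m,s)$-net in base $b$ whose projection onto the $j$-th coordinate is a $(0,m,1)$-net in base $b$ for each $j=1,\dots,s$, and let $\psi(\mathbf x,\mathbf y)$ be the joint pdf of two distinct points randomly chosen from $\tilde P_n$. Then: (i) The base $b$ Walsh decomposition of $\psi$ takes the form $$\psi(\mathbf x,\mathbf y)=1+\sum_{\mathbf l\in\mathbb N^s,\ \mathbf l\neq\mathbf 0}\hat\psi(\mathbf l)\,\mathrm{wal}_{\mathbf l}(\mathbf x)\overline{\mathrm{wal}_{\mathbf l}(\mathbf y)}.$$ (ii) For $\mathbf 0\neq\mathbf l\in\mathbb N^s$, the value of $\hat\psi(\mathbf l)$ in part (i) is $$\hat\psi(\mathbf l)=\frac{1}{n(n-1)}\Big(\frac{b}{b-1}\Big)^{r}\sum_{\mathbf e\in\{0,1\}^s,\ \mathbf e\le\mathbf r}(-1)^{e}b^{-e}M_b(\mathbf k-\mathbf e;\tilde P_n),$$ where $\mathbf r=\mathrm{supp}(\mathbf l)$, $\mathbf k=(|l_1|,\dots,|l_s|)$, $r=r_1+\cdots+r_s$ and $e=e_1+\cdots+e_s$.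
   Context: $\mathbb N=\{0,1,2,\dots\}$; $b$ is a prime, $s,m\ge1$ are integers, $0\le t\le m$, $n=b^m$. Inequalities between vectors are componentwise. Nets. For $\mathbf k\in\mathbb N^s$, a set of $n=b^m$ points in $[0,1)^s$ is $\mathbf k$-equidistributed in base $b$ if every interval $\prod_{j=1}^s[a_jb^{-k_j},(a_j+1)b^{-k_j})$ with $a_j\in\{0,\dots,b^{k_j}-1\}$ contains exactly $b^{m-k_1-\cdots-k_s}$ of the points. It is a $(t,m,s)$-net in base $b$ if it is $\mathbf k$-equidistributed for all $\mathbf k\in\mathbb N^s$ with $k_1+\cdots+k_s\le m-t$. Common digits. For $x,y\in[0,1)$, $\gamma_b(x,y)$ is the number of initial common base $b$ digits of $x$ and $y$ (using finite expansions whenever possible), i.e. the $i$ with $\lfloor b^ix\rfloor=\lfloor b^iy\rfloor$ and $\lfloor b^{i+1}x\rfloor\ne\lfloor b^{i+1}y\rfloor$ ($\infty$ if $x=y$). For $\mathbf x,\mathbf y\in[0,1)^s$, $\gamma_b^s(\mathbf x,\mathbf y)=(\gamma_b(x_1,y_1),\dots,\gamma_b(x_s,y_s))$. For $\mathbf i\in\mathbb N^s$, $D_{\mathbf i}^s=\{(\mathbf x,\mathbf y)\in[0,1)^{2s}:\gamma_b^s(\mathbf x,\mathbf y)=\mathbf i\}$. Scrambling. A scrambled $(t,m,s)$-net in base $b$ is a random point set $\tilde P_n=\{\mathbf U_1,\dots,\mathbf U_n\}$ obtained from a $(t,m,s)$-net $\{\mathbf V_1,\dots,\mathbf V_n\}$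 in base $b$ such that each $\mathbf U_l$ is uniformly distributed on $[0,1)^s$ and, for all $l\neq j$ and $\mathbf i\in\mathbb N^s$, if $(\mathbf V_l,\mathbf V_j)\in D_{\mathbf i}^s$ then $(\mathbf U_l,\mathbf U_j)$ is uniformly distributed in $D_{\mathbf i}^s$. The joint pdf $\psi$ is the density (with respect to Lebesgue measure on $[0,1)^{2s}$, defined up to null sets) of $(\mathbf U_I,\mathbf U_J)$, where $(I,J)$ is a uniformly random ordered pair of distinct indices, independent of the scrambling. Counting numbers. For $\mathbf k\in\mathbb N^s$, $M_b(\mathbf k;\tilde P_n)$ is the number of ordered pairs of distinct points $(\mathbf U_l,\mathbf U_j)$ of $\tilde P_n$ with $\gamma_b^s(\mathbf U_l,\mathbf U_j)\ge\mathbf k$ (scrambling preserves the $\gamma_b^s$ values almost surely, so this is deterministic up to null events). Walsh functions. For $l\in\mathbb N$ with $l=\lambda_0+\lambda_1b+\lambda_2b^2+\cdots$ and $x\in[0,1)$ with $x=\xi_1b^{-1}+\xi_2b^{-2}+\cdots$ (finite expansion if possible), $\mathrm{wal}_l(x)=\omega_b^{\lambda_0\xi_1+\lambda_1\xi_2+\cdots}$ with $\omega_b=e^{2\pi i/b}$; for vectors, $\mathrm{wal}_{\mathbf l}(\mathbf x)=\prod_{j=1}^s\mathrm{wal}_{l_j}(x_j)$. For $\mathbf l\in\mathbb N^s$, $\mathrm{supp}(\mathbf l)$ is the vector $\mathbf r\in\{0,1\}^s$ with $r_j=1$ if $l_j>0$ and $r_j=0$ if $l_j=0$. For $l\in\mathbb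 N$, $|l|$ is the number of base $b$ digits of $l$, i.e. $|0|=0$ and $|l|=k$ when $b^{k-1}\le l<b^k$. *)

(* Defs.v *)
From HB Require Import structures.
From mathcomp Require Import all_boot all_order all_algebra finmap.
From mathcomp Require Import complex.
From mathcomp Require Import all_classical all_reals all_analysis.
Set Implicit Arguments.
Unset Strict Implicit.
Unset Printing Implicit Defensive.
Import Order.TTheory GRing.Theory Num.Theory.
Local Open Scope classical_set_scope.
Local Open Scope ring_scope.

Section Lebesgue_cube.
Context (R : realType).

Definition leb01 : set (measurableTypeR R) -> \bar R :=
  mrestr lebesgue_measure (measurable_itv `[0 : R, 1[%R).

HB.instance Definition _ := Measure.on leb01.

Lemma leb01_setT : leb01 [set: R] = 1%E.
Proof.
by rewrite /leb01 /mrestr setTI lebesgue_measure_itv/= lte_fin ltr01 oppr0 adde0.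
Qed.

HB.instance Definition _ :=
  @Measure_isProbability.Build _ _ R leb01 leb01_setT.

Definition tcons n (p : measurableTypeR R * n.-tuple R) : n.+1.-tuple R :=
  [tuple of (p.1 : R) :: p.2].

Lemma measurable_tcons n :
  measurable_fun [set: measurableTypeR R * n.-tuple R] (@tcons n).
Proof.
apply: measurable_cons; last exact: measurable_snd.
exact: measurable_fst.
Qed.

HB.instance Definition _ n := @isMeasurableFun.Build _ _ _ _ (@tcons n)
  (@measurable_tcons n).

(* Lebesgue measure of R^s restricted to [0,1)^s, as an s-fold product of the
   Lebesgue measure restricted to [0,1): see [lebcube_box]. *)
Fixpoint lebcube (s : nat) : probability (s.-tuple R) R :=
  match s return probability (s.-tuple R) R with
  | 0%N => \d_([tuple] : 0.-tuple R)
  | s'.+1 => distribution (leb01 \x lebcube s')%E (@tcons s')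
  end.

Lemma lebcube_box s (A : 'I_s -> set R) : (forall j, measurable (A j)) ->
  lebcube s [set x | forall j, A j (tnth x j)] = (\prod_(j < s) leb01 (A j))%E.
Proof.
elim: s A => [|s IH] A mA.
  by rewrite big_ord0 /= diracE mem_set//=; case.
rewrite big_ord_recl /= /distribution /pushforward /=.
rewrite -(IH (fun j => A (lift ord0 j)))//.
have mB : measurable [set x : s.-tuple R | forall j, A (lift ord0 j) (tnth x j)].
  have -> : [set x : s.-tuple R | forall j, A (lift ord0 j) (tnth x j)] =
      \bigcap_(j in [set: 'I_s])
        (fun x : s.-tuple R => tnth x j) @^-1` A (lift ord0 j).
    by apply/seteqP; split => [x H j _|x H j]; exact: H.
  apply: fin_bigcap_measurable => // j _.
  by rewrite -[X in measurable X]setTI; exact: measurable_tnth.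
rewrite -product_measure1E//; last exact: (mA ord0).
congr (_ _); apply/seteqP; split => -[x y] /=.
  move=> H; split; first by have := H ord0.
  by move=> j; have := H (lift ord0 j); rewrite /tcons tnthS.
move=> [H0 HS] j; case: (unliftP ord0 j) => [k ->|->//].
by rewrite /tcons tnthS.
Qed.

(* Lebesgue measure restricted to [0,1)^(2s) = [0,1)^s x [0,1)^s. *)
Definition lebcube2 s : probability (s.-tuple R * s.-tuple R)%type R :=
  (lebcube s \x lebcube s)%E.

Definition cube s : set (s.-tuple R) :=
  [set x | forall j, 0 <= tnth x j < 1].

End Lebesgue_cube.

Notation vec s := {ffun 'I_s -> nat}.
Notation bvec s := {ffun 'I_s -> bool}.
Notation zvec := [ffun=> 0%N].

Section Nets.
Context (R : realType) (b : nat).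

Definition elem_interval s (k a : vec s) : pred (s.-tuple R) := fun x =>
  [forall j, (a j)%:R / b%:R ^+ k j <= tnth x j < (a j).+1%:R / b%:R ^+ k j].

Definition equidistributed m s (k : vec s) (V : 'I_(b ^ m) -> s.-tuple R) :=
  forall a : vec s, (forall j, (a j < b ^ k j)%N) ->
  #|[pred i | elem_interval k a (V i)]|%:R
    = (b%:R : R) ^ (m%:Z - (\sum_j k j)%N%:Z).

(* The point set is an indexed family; points are counted with multiplicity. *)
Definition is_net t m s (V : 'I_(b ^ m) -> s.-tuple R) :=
  (forall i, cube (V i)) /\
  (forall k : vec s, (\sum_j k j <= m - t)%N -> @equidistributed m s k V).

Definition projection s n (j : 'I_s) (V : 'I_n -> s.-tuple R) :
  'I_n -> 1.-tuple R := fun i => [tuple tnth (V i) j].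

(* floor (b ^ k * x), for x >= 0 *)
Definition bfloor (k : nat) (x : R) : nat := Num.truncn (b%:R ^+ k * x).

Definition first_split (x y : R) : pred nat := fun i =>
  (bfloor i x == bfloor i y) && (bfloor i.+1 x != bfloor i.+1 y).

(* Values in the extended naturals, [None] standing for infinity; on [0,1[ the
   index i is unique when it exists, and it exists iff x != y. *)
Definition gamma (x y : R) : option nat :=
  if pselect (exists i, first_split x y i) is left h then Some (ex_minn h)
  else None.

Definition le_gamma (k : nat) (g : option nat) : bool :=
  if g is Some i then (k <= i)%N else true.

Definition Dset s (i : vec s) : set (s.-tuple R * s.-tuple R) :=
  [set z | [/\ cube z.1, cube z.2 &
               forall j, gamma (tnth z.1 j) (tnth z.2 j) = Some (i j)]].

Definition Mcount n s (k : vec s) (W : 'I_n -> s.-tuple R) : nat :=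
  #|[pred p : 'I_n * 'I_n | (p.1 != p.2) &&
      [forall j, le_gamma (k j) (gamma (tnth (W p.1) j) (tnth (W p.2) j))]]|.

End Nets.
Arguments equidistributed {R} b m {s} k V.
Arguments is_net {R} b t m {s} V.

Section Scrambling.
Context (R : realType) d (Omega : measurableType d) (P : probability Omega R).

Definition scrambling b n s (V : 'I_n -> s.-tuple R)
    (U : 'I_n -> {RV P >-> s.-tuple R}) :=
  (forall l (A : set (s.-tuple R)), measurable A ->
     P [set w | A (U l w)] = lebcube R s A) /\
  (forall l j (i : vec s), l != j -> Dset b i (V l, V j) ->
     forall A : set (s.-tuple R * s.-tuple R), measurable A ->
     P [set w | A (U l w, U j w)] =
     (fine (lebcube2 R s (A `&` Dset b i)) / fine (lebcube2 R s (Dset b i)))%:E).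

(* (I, J) is uniform on the ordered pairs of distinct indices and independent
   of the sigma-algebra generated by the points U. *)
Definition random_distinct_pair n s (U : 'I_n -> {RV P >-> s.-tuple R})
    (I J : Omega -> 'I_n) :=
  [/\ forall l j, measurable [set w | I w = l /\ J w = j],
      forall l j, P [set w | I w = l /\ J w = j] =
        (if l == j then 0 else (n%:R * (n%:R - 1))^-1)%:E &
      forall l j (E : set Omega),
        g_sigma_preimage (fun i => U i : Omega -> s.-tuple R) E ->
        P ([set w | I w = l /\ J w = j] `&` E) =
        (P [set w | I w = l /\ J w = j] * P E)%E].

Definition joint_pdf n s (U : 'I_n -> {RV P >-> s.-tuple R})
    (I J : Omega -> 'I_n) (psi : s.-tuple R * s.-tuple R -> R) :=
  [/\ measurable_fun [set: s.-tuple R * s.-tuple R] psi,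
      forall z, 0 <= psi z &
      forall A : set (s.-tuple R * s.-tuple R), measurable A ->
        P [set w | A (U (I w) w, U (J w) w)] =
        (\int[lebcube2 R s]_(z in A) (psi z)%:E)%E].

End Scrambling.

Section Walsh.
Context (R : realType) (b : nat).

Definition ndigits (l : nat) : nat :=
  if l == 0%N then 0%N else (trunc_log b l).+1.

Definition nat_digit (l k : nat) : nat := ((l %/ b ^ k) %% b)%N.

(* xi_k, the k-th base b digit of x in [0,1[ after the radix point (k >= 1);
   floors select the finite expansion *)
Definition real_digit (x : R) (k : nat) : nat := (bfloor b k x %% b)%N.

Definition omega : R[i] :=
  Complex (cos (2 * pi / b%:R)) (sin (2 * pi / b%:R)).

Definition wal1 (l : nat) (x : R) : R[i] :=
  omega ^+ (\sum_(k < ndigits l) nat_digit l k * real_digit x k.+1)%N.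

Definition wal s (l : vec s) (x : s.-tuple R) : R[i] :=
  \prod_j wal1 (l j) (tnth x j).

Definition Cintegral d (T : measurableType d)
    (mu : {measure set T -> \bar R}) (f : T -> R[i]) : R[i] :=
  Complex (\int[mu]_z complex.Re (f z)) (\int[mu]_z complex.Im (f z)).

(* Coefficient of f along wal_l(x) * conj (wal_l'(y)). *)
Definition walsh_coef s (f : s.-tuple R * s.-tuple R -> R) (l l' : vec s) :
    R[i] :=
  Cintegral (lebcube2 R s)
    (fun z => (f z)%:C%C * conjc (wal l z.1) * wal l' z.2).

Definition supp s (l : vec s) : bvec s := [ffun j => (0 < l j)%N].

Definition digit_lengths s (l : vec s) : vec s := [ffun j => ndigits (l j)].

Definition bsum s (e : bvec s) : nat := (\sum_j e j)%N.

Definition le_bvec s (e r : bvec s) : bool := [forall j, (e j <= r j)%N].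

Definition sub_vec s (k : vec s) (e : bvec s) : vec s :=
  [ffun j => (k j - e j)%N].

End Walsh.

(* Unconditional convergence of the family f, restricted to D, to S: the net of
   finite partial sums converges. *)
Definition has_sum (C : numDomainType) (I : choiceType) (D : pred I)
    (f : I -> C) (S : C) :=
  forall eps : C, 0 < eps -> exists F0 : {fset I},
  forall F : {fset I}, (F0 `<=` F)%fset ->
    `|\sum_(i <- F | D i) f i - S| < eps.

(* Main.v *)
(* Since every one-dimensional projection is a (0,m,1)-net, two distinct points
   of V have a common-digit vector i with all entries below m, so the
   corresponding pair of scrambled points is uniform on D_i, and psi is almost everywhere the
   average over ordered pairs of the normalized indicators of the sets D_i.
   Coordinatewise such an indicator is [i common digits] - [i+1 common digits],
   and [k common digits] = b^-k sum_(l < b^k) wal_l(x) conj(wal_l(y)), a finite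
   kernel: the Walsh series of psi is therefore a finite sum.  Every function
   involved is constant on the cells of a grid of mesh b^-K, which turns the
   coefficients into finite sums over grid points, where orthogonality of the
   Walsh functions follows from the kernel formula because a left inverse of a
   square matrix is also a right inverse. *)

Require Import Defs.
From HB Require Import structures.
From mathcomp Require Import all_boot all_order all_algebra finmap.
From mathcomp Require Import complex.
From mathcomp Require Import all_classical all_reals all_analysis.
From mathcomp Require Import measurable_realfun.
From mathcomp Require Import ring.
Set Implicit Arguments.
Unset Strict Implicit.
Unset Printing Implicit Defensive.
Import Order.TTheory GRing.Theory Num.Theory.
Local Open Scope classical_set_scope.
Local Open Scope ring_scope.

(** * Base b digits, common initial digits and grid points *)

Section Digits.
Context (R : realType) (b : nat) (b_gt0 : (0 < b)%N).
Implicit Types x y : R.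

Let bX_gt0 k : (0 : R) < b%:R ^+ k.
Proof. by rewrite exprn_gt0// ltr0n. Qed.

(** Truncating at level K and then discarding the last K - k digits is truncating at level k.
    Agreement of two points at one level therefore passes to all lower levels. *)
Lemma bfloor_div k K x : (k <= K)%N ->
  bfloor b k x = (bfloor b K x %/ b ^ (K - k))%N.
Proof.
move=> kK; rewrite /bfloor.
(* On negative reals [Num.truncn] takes its default value 0 at every level. *)
have [x0|x0] := ltP x 0.
  have neg i : Num.truncn (b%:R ^+ i * x) = 0%N.
    apply/truncn0Pn; rewrite -ltNge (le_lt_trans _ ltr01)//.
    by rewrite mulr_ge0_le0// ltW.
  by rewrite !neg div0n.
set d := (b ^ (K - k))%N; have d0 : (0 < d)%N by rewrite expn_gt0 b_gt0.
have -> : b%:R ^+ K * x = d%:R * (b%:R ^+ k * x).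
  by rewrite mulrA natrX -exprD subnK.
set y := b%:R ^+ k * x.
have y0 : 0 <= y by rewrite mulr_ge0// ltW.
have dy0 : 0 <= d%:R * y by rewrite mulr_ge0.
apply/eqP; rewrite truncn_eq//.
have /andP[nl nu] := truncn_itv dy0; set n := Num.truncn _ in nl nu *.
apply/andP; split.
  rewrite -(ler_pM2l (x := d%:R)) ?ltr0n// -natrM (le_trans _ nl)// ler_nat.
  by rewrite mulnC leq_divM.
rewrite -(ltr_pM2l (x := d%:R)) ?ltr0n// -natrM (lt_le_trans nu)// ler_nat.
by rewrite mulnC ltn_ceil.
Qed.

Lemma eq_bfloor_le k K x y : (k <= K)%N ->
  bfloor b K x = bfloor b K y -> bfloor b k x = bfloor b k y.
Proof. by move=> kK e; rewrite !(bfloor_div _ kK) e. Qed.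

Lemma eq_real_digit k K x y : (k <= K)%N ->
  bfloor b K x = bfloor b K y -> real_digit b x k = real_digit b y k.
Proof. by move=> kK e; rewrite /real_digit (eq_bfloor_le kK e). Qed.

Lemma eq_wal1 l K x y : (ndigits b l <= K)%N ->
  bfloor b K x = bfloor b K y -> wal1 b l x = wal1 b l y.
Proof.
move=> lK e; congr (_ ^+ _); apply: eq_bigr => i _.
by rewrite (eq_real_digit _ e)// (leq_trans (ltn_ord i)).
Qed.

Lemma eq_first_split i K x y x' y' : (i < K)%N ->
  bfloor b K x = bfloor b K x' -> bfloor b K y = bfloor b K y' ->
  first_split b x y i = first_split b x' y' i.
Proof.
move=> iK ex ey; rewrite /first_split.
by rewrite !(eq_bfloor_le (ltnW iK) ex, eq_bfloor_le (ltnW iK) ey,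
  eq_bfloor_le iK ex, eq_bfloor_le iK ey).
Qed.

(** If i < j, agreement at level j forces agreement at level i + 1, which a split at i excludes. The
    minimum chosen in [gamma] is thus the only witness. *)
Lemma first_split_uniq x y i j :
  first_split b x y i -> first_split b x y j -> i = j.
Proof.
wlog ij : i j / (i <= j)%N => [H fi fj|].
  by case/orP: (leq_total i j) => h; [|symmetry]; exact: H.
move: ij; rewrite leq_eqVlt => /orP[/eqP//|ij].
move=> /andP[_ /eqP ne] /andP[/eqP e _].
by case: ne; exact: eq_bfloor_le e.
Qed.

Lemma gammaP x y i : reflect (gamma b x y = Some i) (first_split b x y i).
Proof.
apply: (iffP idP); rewrite /gamma; case: pselect => [h|nh].
- by move=> fi; case: ex_minnP => j fj _; rewrite (first_split_uniq fj fi).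
- by move=> fi; case: nh; exists i.
- by case: ex_minnP => j fj _ [<-].
- by [].
Qed.

(** The floors agree at level 0 and differ at level K, so the last level of agreement lies in
    between; the induction descends from K to find it. *)
Lemma gamma_lt K x y : bfloor b 0 x = bfloor b 0 y ->
  bfloor b K x != bfloor b K y ->
  exists2 i, (i < K)%N & gamma b x y = Some i.
Proof.
move=> e0; elim: K => [/eqP//|K IH].
have [eK ne|/IH[i iK gi] _] := eqVneq (bfloor b K x) (bfloor b K y).
  by exists K => //; apply/gammaP; rewrite /first_split eK eqxx.
by exists i => //; exact: ltnW.
Qed.

Lemma bfloor0 x : 0 <= x < 1 -> bfloor b 0 x = 0%N.
Proof.
move=> /andP[_ x1]; apply/truncn0Pn.
by rewrite expr0 mul1r -ltNge.
Qed.

(** The left endpoint represents the cell [a b^-K, (a + 1) b^-K). *)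
Definition grid K (a : nat) : R := a%:R / b%:R ^+ K.

Lemma bfloor_grid K a : bfloor b K (grid K a) = a.
Proof. by rewrite /bfloor /grid mulrC divfK ?gt_eqF// natrK. Qed.

Lemma grid_itv K (a : 'I_(b ^ K)) : 0 <= grid K a < 1.
Proof.
rewrite divr_ge0 ?ler0n//= ?ltW// ltr_pdivrMr// mul1r -natrX ltr_nat.
exact: ltn_ord.
Qed.

Lemma bfloor_bound K x : 0 <= x < 1 -> (bfloor b K x < b ^ K)%N.
Proof.
move=> /andP[x0 x1]; rewrite truncn_lt_nat ?mulr_ge0// ?ltW//.
by rewrite natrX -[ltRHS]mulr1 ltr_pM2l.
Qed.

Lemma bfloor_eqP K a x : 0 <= x ->
  (bfloor b K x == a) = (grid K a <= x < grid K a.+1).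
Proof.
move=> x0; rewrite truncn_eq ?mulr_ge0 ?(ltW (bX_gt0 _))//.
by rewrite /grid ler_pdivrMr// ltr_pdivlMr// !(mulrC x).
Qed.

End Digits.

Lemma ndigits_leq b l K : (1 < b)%N -> (ndigits b l <= K)%N = (l < b ^ K)%N.
Proof.
move=> b1; rewrite /ndigits; have [->|l0] := eqVneq l 0%N.
  by rewrite leq0n expn_gt0 ltnW.
apply/idP/idP => [tK|]; first by rewrite (leq_trans (trunc_log_ltn l b1))// leq_exp2l.
apply: contraLR; rewrite -!leqNgt => Kt.
by rewrite (leq_trans _ (trunc_logP b1 _)) ?lt0n// leq_exp2l.
Qed.

(** * Univariate Walsh functions and their kernel *)

Section Walsh1.
Context (R : realType) (b : nat) (b_prime : prime b).
Local Notation omega := (omega R b).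
Local Notation wal1 := (wal1 b).
Implicit Types x y : R.

Let b_gt1 : (1 < b)%N. Proof. exact: prime_gt1. Qed.
Let b_gt0 : (0 < b)%N. Proof. exact: prime_gt0. Qed.

Lemma complex_cos_sinX (x : R) n :
  Complex (cos x) (sin x) ^+ n = Complex (cos (x *+ n)) (sin (x *+ n)).
Proof.
elim: n => [|n IH]; first by rewrite expr0 mulr0n cos0 sin0.
rewrite exprS IH mulrS cosD sinD; congr Complex.
by rewrite addrC (mulrC (sin x)).
Qed.

Lemma omegaX : omega ^+ b = 1.
Proof.
have e : (2 * pi / b%:R) *+ b = pi *+ 2 :> R.
  by rewrite -(mulr_natr _ b) divfK ?pnatr_eq0 -?lt0n// mulrC mulr_natr.
by rewrite complex_cos_sinX e cos2pi sin2pi.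
Qed.

Lemma omega_neq1 : omega != 1.
Proof.
apply/eqP => -[] c1 _.
have b2 : (2 : R) <= b%:R by rewrite ler_nat.
have b0 : (0 : R) < b%:R by rewrite ltr0n.
have : 2 * pi / b%:R = 0 :> R.
  (* The angle 2 pi / b lies in [0, pi] because b >= 2, and the cosine is injective there. *)
  apply: cos_inj; rewrite ?c1 ?cos0// in_itv/= ?lexx ?pi_ge0//.
  rewrite divr_ge0 ?mulr_ge0 ?pi_ge0 ?ler0n//=.
  by rewrite ler_pdivrMr// mulrC ler_wpM2l ?pi_ge0.
by apply/eqP; rewrite mulf_neq0 ?mulf_neq0 ?invr_eq0 ?gt_eqF ?pi_gt0.
Qed.

(** The order of [omega] divides the prime b and is not 1. *)
Lemma omega_prim : b.-primitive_root omega.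
Proof.
have [k prim_k kb] := prim_order_exists b_gt0 omegaX.
have [k1|k1] := eqVneq k 1%N.
  by move: prim_k; rewrite k1 => /prim_expr_order/eqP; rewrite expr1 (negPf omega_neq1).
by move: prim_k; rewrite (prime_nt_dvdP b_prime k1 kb).
Qed.

Lemma omega_neq0 : omega != 0.
Proof. by rewrite -unitfE -(unitrX_pos _ b_gt0) omegaX unitr1. Qed.

Lemma conj_omega : conjc omega = omega^-1.
Proof.
apply: (mulfI omega_neq0); rewrite divff ?omega_neq0//.
apply/eqP; rewrite eq_complex /=; apply/andP; split.
  by rewrite mulrN opprK -!expr2 cos2Dsin2.
by rewrite mulrN addrC mulrC subrr.
Qed.

Lemma conj_omegaX n : conjc (omega ^+ n) = omega ^- n.
Proof. by rewrite -exprVn -conj_omega; exact: rmorphXn. Qed.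

(** A geometric sum in z = omega^(u - v): constant when u = v, and otherwise zero because z^b = 1
    and z != 1. *)
Lemma sum_omega (u v : nat) : (u < b)%N -> (v < b)%N ->
  \sum_(c < b) omega ^+ (c * u) * conjc (omega ^+ (c * v))
  = b%:R * (u == v)%:R.
Proof.
move=> ub vb.
have om0 := omega_neq0.
pose z := omega ^+ u / omega ^+ v.
have -> : \sum_(c < b) omega ^+ (c * u) * conjc (omega ^+ (c * v)) =
    \sum_(c < b) z ^+ c.
  apply: eq_bigr => c _.
  by rewrite conj_omegaX /z exprMn exprVn -!exprM !(mulnC c).
have [uv|uv] := eqVneq u v.
  rewrite /z uv divff ?expf_neq0// mulr1 (eq_bigr (fun=> 1)) => [|c _].
    by rewrite sumr_const card_ord.
  by rewrite expr1n.
(* The inserted [false] is then replaced by [z - 1 == 0], so that the goal becomes the vanishing of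
   (z - 1) times the sum, that is of z^b - 1. *)
rewrite mulr0; apply/eqP; rewrite -[_ == 0]orFb.
have <- : (z - 1 == 0) = false.
  rewrite subr_eq0 /z -[X in _ == X](divff (x := omega ^+ v)) ?expf_neq0//.
  rewrite (inj_eq (mulIf _)) ?invr_eq0 ?expf_neq0//.
  by rewrite (eq_prim_root_expr omega_prim) !modn_small// (negPf uv).
rewrite -mulf_eq0 -subrX1 /z expr_div_n -!exprM !(mulnC _ b) !exprM omegaX.
by rewrite !expr1n divr1 subrr.
Qed.

Lemma nat_digit0 l k : (l < b ^ k)%N -> nat_digit b l k = 0%N.
Proof. by move=> lk; rewrite /nat_digit divn_small// mod0n. Qed.

(** The digits of l beyond its length are zero, so the exponent can be summed up to a length common
    to all l < b^N. *)
Lemma wal1E N l x : (l < b ^ N)%N ->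
  wal1 l x = omega ^+ (\sum_(k < N) nat_digit b l k * real_digit b x k.+1).
Proof.
move=> lN; congr (_ ^+ _).
have nN : (ndigits b l <= N)%N by rewrite ndigits_leq.
rewrite (big_ord_widen N (fun k => nat_digit b l k * real_digit b x k.+1)%N nN).
rewrite [RHS](bigID (fun k : 'I_N => (k < ndigits b l)%N))/=.
rewrite [X in _ = (_ + X)%N]big1 ?addn0// => k; rewrite -leqNgt => lk.
by rewrite nat_digit0// -ndigits_leq.
Qed.

(** Adding c b^N keeps the digits of l below position N and puts c at position N, where it meets the
    digit N + 1 of x. *)
Lemma wal1_add N l c x : (l < b ^ N)%N -> (c < b)%N ->
  wal1 (l + c * b ^ N) x = wal1 l x * omega ^+ (c * real_digit b x N.+1).
Proof.
move=> lN cb.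
have lcN : (l + c * b ^ N < b ^ N.+1)%N.
  rewrite expnS (@leq_trans (b ^ N + c * b ^ N))%N ?ltn_add2r// -mulSn.
  by rewrite leq_mul2r cb orbT.
rewrite (wal1E x lcN) (wal1E x lN) -exprD big_ord_recr/=.
congr (omega ^+ (_ + _ * _)); last first.
  rewrite /nat_digit (addnC l) divnMDl ?expn_gt0 ?b_gt0//.
  by rewrite divn_small// addn0 modn_small.
apply: eq_bigr => k _; congr (_ * _)%N; rewrite /nat_digit.
have -> : (c * b ^ N = c * b ^ (N - k.+1) * b * b ^ k)%N.
  by rewrite -!mulnA -expnS -expnD subnK.
by rewrite addnC divnMDl ?expn_gt0 ?b_gt0// modnMDl.
Qed.

Lemma eq_bfloorS N x y : (bfloor b N.+1 x == bfloor b N.+1 y) =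
  (bfloor b N x == bfloor b N y) && (real_digit b x N.+1 == real_digit b y N.+1).
Proof.
apply/eqP/andP => [e|[/eqP eN /eqP ed]].
  by rewrite (eq_bfloor_le b_gt0 (leqnSn N) e) (eq_real_digit b_gt0 (leqnn _) e).
rewrite (divn_eq (bfloor b N.+1 x) b) (divn_eq (bfloor b N.+1 y) b).
move: eN; rewrite !(bfloor_div b_gt0 _ (leqnSn N)) subSnn expn1 => ->.
by move: ed; rewrite /real_digit => ->.
Qed.

(** The Walsh-Dirichlet kernel. Induction on N: the sum over the leading digit of l is a character
    sum that tests equality of the digits N + 1 of x and y. *)
Lemma wal1_kernel N x y : bfloor b 0 x = bfloor b 0 y ->
  \sum_(l < b ^ N) wal1 l x * conjc (wal1 l y) =
  (b ^ N)%:R * (bfloor b N x == bfloor b N y)%:R.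
Proof.
move=> e0; elim: N => [|N IH].
  rewrite expn0 big_ord1 e0 eqxx mulr1 /wal1 /ndigits eqxx !big_ord0.
  by rewrite !expr0 conjc1 mulr1.
rewrite -(big_mkord xpredT (fun l => wal1 l x * conjc (wal1 l y))) expnS.
(* The range below b^(N+1) is cut into b blocks of length b^N, one for each leading digit c. *)
rewrite big_nat_mul big_mkord.
transitivity (\sum_(c < b) (omega ^+ (c * real_digit b x N.+1) *
    conjc (omega ^+ (c * real_digit b y N.+1)) *
    \sum_(l < b ^ N) wal1 l x * conjc (wal1 l y))).
  apply: eq_bigr => c _; rewrite -{1}[(c * _)%N]add0n big_addn mulSn addnK.
  rewrite big_mkord mulr_sumr; apply: eq_bigr => l _.
  by rewrite !wal1_add//= rmorphM/=; ring.
rewrite -mulr_suml IH sum_omega ?ltn_mod// eq_bfloorS natrM.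
by case: (_ == _); case: (_ == _); rewrite ?(mulr0, mul0r, mulr1).
Qed.

End Walsh1.

(** * Orthogonality and the univariate density for i common digits *)

Section SplitDensity.
Context (R : realType) (b : nat) (b_prime : prime b).
Local Notation wal1 := (wal1 b).
Local Notation grid := (grid R b).
Implicit Types x y : R.

Let b_gt1 : (1 < b)%N. Proof. exact: prime_gt1. Qed.
Let b_gt0 : (0 < b)%N. Proof. exact: prime_gt0. Qed.
Let bX_neq0 k : (b ^ k)%:R != 0 :> R[i].
Proof. by rewrite pnatr_eq0 -lt0n expn_gt0 b_gt0. Qed.

Lemma wal1_ortho K l l' : (l < b ^ K)%N -> (l' < b ^ K)%N ->
  \sum_(a < b ^ K) wal1 l (grid K a) * conjc (wal1 l' (grid K a)) =
  (b ^ K)%:R * (l == l')%:R.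
Proof.
move=> lK l'K.
pose A : 'M[R[i]]_(b ^ K) := \matrix_(a, l) wal1 l (grid K a).
pose B : 'M[R[i]]_(b ^ K) :=
  \matrix_(l, a) ((b ^ K)%:R^-1 * conjc (wal1 l (grid K a))).
(* B is the scaled adjoint of A. Distinct grid points have distinct floors at level K, so the kernel
   gives A B = 1, and reading B A = 1 entrywise gives the orthogonality. *)
have AB : A *m B = 1%:M.
  apply/matrixP => a a'; rewrite !mxE.
  have -> : \sum_j A a j * B j a' = (b ^ K)%:R^-1 *
      \sum_(l < b ^ K) wal1 l (grid K a) * conjc (wal1 l (grid K a')).
    by rewrite mulr_sumr; apply: eq_bigr => j _; rewrite !mxE mulrCA.
  rewrite wal1_kernel// ?bfloor0 ?grid_itv// !bfloor_grid// mulKf//.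
have /matrixP/(_ (Ordinal l'K) (Ordinal lK)) := mulmx1C AB.
rewrite !mxE -val_eqE/= eq_sym => <-.
rewrite mulr_sumr; apply: eq_bigr => j _.
by rewrite !mxE/= -[X in _ = _ * X]mulrA [RHS]mulrA divff// mul1r mulrC.
Qed.

(* The density of the uniform distribution on the set of (x, y) in [0,1)^2 with
   exactly i common digits, a set of measure (b - 1) / b^(i+1). *)
Definition split_density i x y : R :=
  if first_split b x y i then b%:R ^+ i.+1 / (b%:R - 1) else 0.

(** The three cases evaluate (b [l < b^i] - [l < b^(i+1)]) / (b - 1), the coefficient that comes
    from subtracting the kernels of levels i and i + 1. *)
Definition split_coef i l : R :=
  if (l < b ^ i)%N then 1 else if (l < b ^ i.+1)%N then - (b%:R - 1)^-1 else 0.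

(** Having exactly i common digits is the difference of two kernels, b times that of level i minus
    that of level i + 1, both padded with zero coefficients up to b^N. *)
Lemma split_density_walsh N i x y : (i < N)%N -> bfloor b 0 x = bfloor b 0 y ->
  ((split_density i x y)%:C)%C =
  \sum_(l < b ^ N) ((split_coef i l)%:C)%C * wal1 l x * conjc (wal1 l y).
Proof.
move=> iN e0.
have b1 : b%:R - 1 != 0 :> R.
  by rewrite subr_eq0 pnatr_eq1 gtn_eqF.
have kern k : (k <= N)%N ->
    \sum_(l < b ^ N) (l < b ^ k)%N%:R * (wal1 l x * conjc (wal1 l y)) =
    (b ^ k)%:R * (bfloor b k x == bfloor b k y)%:R.
  move=> kN; rewrite -wal1_kernel//.
  rewrite (big_ord_widen (b ^ N) (fun l => wal1 l x * conjc (wal1 l y))).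
    by rewrite [RHS]big_mkcond; apply: eq_bigr => l _; case: ifP; rewrite ?mul1r ?mul0r.
  by rewrite leq_exp2l.
have coefE l : ((split_coef i l)%:C)%C = (((b%:R - 1)^-1)%:C)%C *
    (b%:R * (l < b ^ i)%N%:R - (l < b ^ i.+1)%N%:R).
  rewrite /split_coef; have [li|li] := ltnP l (b ^ i).
    rewrite (leq_trans li) ?leq_exp2l// mulr1.
    have <- : (((b%:R - 1 : R))%:C)%C = b%:R - 1 by rewrite rmorphB rmorph_nat rmorph1.
    by rewrite -rmorphM mulVf.
  case: ifP => _; rewrite mulr0 sub0r ?oppr0 ?mulr0// mulrN mulr1.
  by rewrite -rmorphN.
transitivity ((((b%:R - 1)^-1)%:C)%C * (b%:R *
   (\sum_(l < b ^ N) (l < b ^ i)%N%:R * (wal1 l x * conjc (wal1 l y)))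
   - \sum_(l < b ^ N) (l < b ^ i.+1)%N%:R * (wal1 l x * conjc (wal1 l y)))); last first.
  rewrite mulr_sumr -sumrB mulr_sumr; apply: eq_bigr => l _.
  by rewrite coefE; ring.
rewrite !kern// ?(ltnW iN)// mulrA -natrM -expnS -mulrBr /split_density /first_split.
have [eS|neS] := eqVneq (bfloor b i.+1 x) _.
  by rewrite (eq_bfloor_le b_gt0 (leqnSn i) eS) eqxx/= subrr !mulr0.
rewrite subr0 andbT; case: ifP => _; rewrite ?mulr0// mulr1.
by rewrite -natrX mulrC rmorphM rmorph_nat.
Qed.

Lemma sum_split_density K i l l' : (i < K)%N -> (l < b ^ K)%N -> (l' < b ^ K)%N ->
  \sum_(a < b ^ K) \sum_(a' < b ^ K)
    ((split_density i (grid K a) (grid K a'))%:C)%C *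
    conjc (wal1 l (grid K a)) * wal1 l' (grid K a') =
  (b ^ K)%:R ^+ 2 * ((l == l')%:R * ((split_coef i l)%:C)%C).
Proof.
move=> iK lK l'K.
(* Inserting the finite expansion separates a from a'; orthogonality of each factor then leaves only
   h = l = l'. *)
transitivity (\sum_(h < b ^ K) ((split_coef i h)%:C)%C *
   (\sum_(a < b ^ K) wal1 h (grid K a) * conjc (wal1 l (grid K a))) *
   (\sum_(a < b ^ K) wal1 l' (grid K a) * conjc (wal1 h (grid K a)))).
  transitivity (\sum_(a < b ^ K) \sum_(a' < b ^ K) \sum_(h < b ^ K)
    ((split_coef i h)%:C)%C * (wal1 h (grid K a) * conjc (wal1 l (grid K a))) *
     (wal1 l' (grid K a') * conjc (wal1 h (grid K a')))).
    apply: eq_bigr => a _; apply: eq_bigr => a' _.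
    rewrite (split_density_walsh iK) ?bfloor0 ?grid_itv// !mulr_suml.
    by apply: eq_bigr => h _; ring.
  under eq_bigr do rewrite exchange_big/=.
  rewrite exchange_big/=; apply: eq_bigr => h _.
  rewrite -mulrA big_distrlr/= mulr_sumr; apply: eq_bigr => a _.
  by rewrite mulr_sumr; apply: eq_bigr => a' _; rewrite !mulrA.
under eq_bigr => h _ do
  rewrite (wal1_ortho (ltn_ord h) lK) (wal1_ortho l'K (ltn_ord h)).
rewrite (bigD1 (Ordinal lK))//= big1 ?addr0 => [|h hl]; last first.
  rewrite (_ : (h == l :> nat) = false) ?mulr0 ?mul0r//.
  by apply: contraNF hl => /eqP hl; apply/eqP/val_inj.
rewrite eqxx (eq_sym l') mulr1.
have ringE (u v w : R[i]) : u * v * (v * w) = v ^+ 2 * (w * u) by ring.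
exact: ringE.
Qed.

Lemma wal1_0 x : wal1 0 x = 1.
Proof. by rewrite /Defs.wal1 /ndigits eqxx big_ord0. Qed.

End SplitDensity.

(** * Tensor products over the coordinates *)

Section SplitDensityVec.
Context (R : realType) (b s : nat) (b_prime : prime b).
Implicit Types (x y : s.-tuple R) (i l : vec s).

Let b_gt0 : (0 < b)%N. Proof. exact: prime_gt0. Qed.

(** Vectors with entries below N form a finite type, over which sums can range; this embeds it into
    all vectors. *)
Definition vec_of N (f : {ffun 'I_s -> 'I_N}) : vec s := [ffun j => (f j : nat)].

Definition gridvec K (a : vec s) : s.-tuple R := [tuple grid R b K (a j) | j < s].

Definition split_density_vec i (z : s.-tuple R * s.-tuple R) : R :=
  \prod_j split_density b (i j) (tnth z.1 j) (tnth z.2 j).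

Definition split_coef_vec i l : R := \prod_j split_coef R b (i j) (l j).

Lemma conj_wal l x : conjc (wal b l x) = \prod_j conjc (wal1 b (l j) (tnth x j)).
Proof. by rewrite /wal rmorph_prod. Qed.

Lemma split_density_vec_walsh N i x y : (forall j, i j < N)%N ->
  cube x -> cube y ->
  ((split_density_vec i (x, y))%:C)%C =
  \sum_(f : {ffun 'I_s -> 'I_(b ^ N)})
    ((split_coef_vec i (vec_of f))%:C)%C *
      wal b (vec_of f) x * conjc (wal b (vec_of f) y).
Proof.
move=> iN cx cy; rewrite rmorph_prod/=.
under eq_bigr => j _ do rewrite (split_density_walsh b_prime (iN j))
  ?(bfloor0 _ (cx j)) ?(bfloor0 _ (cy j))//.
rewrite bigA_distr_bigA; apply: eq_bigr => f _.
rewrite conj_wal /wal rmorph_prod/= -!big_split/=.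
by apply: eq_bigr => j _; rewrite ffunE.
Qed.

(** Summand and range are products over j, so the sum is the product of the univariate ones; a
    single coordinate with l_j != l'_j annihilates it. *)
Lemma sum_split_density_vec K i l l' : (forall j, i j < K)%N ->
  (forall j, l j < b ^ K)%N -> (forall j, l' j < b ^ K)%N ->
  \sum_(f : {ffun 'I_s -> 'I_(b ^ K)}) \sum_(g : {ffun 'I_s -> 'I_(b ^ K)})
    ((split_density_vec i (gridvec K (vec_of f), gridvec K (vec_of g)))%:C)%C *
    conjc (wal b l (gridvec K (vec_of f))) * wal b l' (gridvec K (vec_of g)) =
  (b ^ K)%:R ^+ 2 ^+ s * ((l == l')%:R * ((split_coef_vec i l)%:C)%C).
Proof.
move=> iK lK l'K.
pose F j a a' := ((split_density b (i j) (grid R b K a) (grid R b K a'))%:C)%C *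
    conjc (wal1 b (l j) (grid R b K a)) * wal1 b (l' j) (grid R b K a').
transitivity (\prod_(j < s) \sum_(a < b ^ K) \sum_(a' < b ^ K) F j a a').
  rewrite bigA_distr_bigA; apply: eq_bigr => f _.
  rewrite bigA_distr_bigA; apply: eq_bigr => g _.
  rewrite conj_wal /wal rmorph_prod/= -!big_split/=.
  by apply: eq_bigr => j _; rewrite !tnth_mktuple !ffunE.
under eq_bigr => j _ do rewrite (sum_split_density R b_prime (iK j) (lK j) (l'K j)).
rewrite !big_split/= prodr_const card_ord rmorph_prod/=; congr (_ * (_ * _)).
  by rewrite -exprMn -expr2.
have [e|ll'] := eqVneq l l'; first by rewrite big1// => j _; rewrite e eqxx.
have /existsP[j lj] : [exists j, l j != l' j].
  apply: contraNT ll'; rewrite negb_exists => /forallP H.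
  by apply/eqP/ffunP => j; apply/eqP/negbNE/H.
by rewrite (bigD1 j)//= (negPf lj) mul0r.
Qed.

Lemma wal_0 x : wal b zvec x = 1.
Proof. by rewrite /wal big1// => j _; rewrite ffunE wal1_0. Qed.

Lemma split_coef_vec0 i : split_coef_vec i zvec = 1.
Proof.
by rewrite /split_coef_vec big1// => j _; rewrite ffunE /split_coef expn_gt0 b_gt0.
Qed.

End SplitDensityVec.

(** * Measurability and measure of grid cells *)

Section Cells.
Context (R : realType) (b s : nat) (b_gt0 : (0 < b)%N).
Implicit Types (x : s.-tuple R) (a : vec s).

Let bX_gt0 k : (0 : R) < b%:R ^+ k.
Proof. by rewrite exprn_gt0// ltr0n. Qed.

(** Truncation sends all negative reals to 0, so sublevel sets are half-lines and a level set is a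
    difference of two of them. *)
Lemma measurable_bfloor K n : measurable [set x : R | bfloor b K x = n].
Proof.
have le_itv k : [set x : R | (bfloor b K x <= k)%N] = `]-oo, grid R b K k.+1[%classic.
  apply/seteqP; split => x /=; rewrite in_itv/= /bfloor truncn_le_nat /grid;
  by rewrite ltr_pdivlMr// mulrC.
case: n => [|n].
  rewrite (_ : mkset _ = [set x | (bfloor b K x <= 0)%N]); first by rewrite le_itv.
  by apply/seteqP; split => x; rewrite /mkset leqn0 => /eqP.
rewrite (_ : mkset _ = [set x | (bfloor b K x <= n.+1)%N] `\`
    [set x | (bfloor b K x <= n)%N]); first by rewrite !le_itv; exact: measurableD.
apply/seteqP; split => x /=; first by move=> ->; rewrite leqnn ltnn.
by move=> [h1 /negP h2]; apply/eqP; rewrite eqn_leq h1 ltnNge.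
Qed.

Definition cell K x : vec s := [ffun j => bfloor b K (tnth x j)].

Definition cell2 K (z : s.-tuple R * s.-tuple R) := (cell K z.1, cell K z.2).

Lemma cellP K x a : cell K x = a <-> forall j, bfloor b K (tnth x j) = a j.
Proof.
split=> [<- j|H]; first by rewrite ffunE.
by apply/ffunP => j; rewrite ffunE.
Qed.

Lemma measurable_cell K a : measurable [set x | cell K x = a].
Proof.
have -> : [set x | cell K x = a] = \bigcap_(j in [set: 'I_s])
    (fun x : s.-tuple R => tnth x j) @^-1` [set u | bfloor b K u = a j].
  apply/seteqP; split => [x /cellP H j _|x H]; first exact: H.
  by apply/cellP => j; exact: H.
apply: fin_bigcap_measurable => // j _.
rewrite -[X in measurable X]setTI; apply: measurable_tnth => //.
exact: measurable_bfloor.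
Qed.

(** Cell indices are countable, so an arbitrary union of cells is measurable. *)
Lemma measurable_cell2 K (S : set (vec s * vec s)) :
  measurable [set z | S (cell2 K z)].
Proof.
have -> : [set z | S (cell2 K z)] = \bigcup_c [set z | cell2 K z = c /\ S c].
  apply/seteqP; split => [z Sz|z [c _ [<-]]//].
  by exists (cell2 K z).
apply: countable_bigcupT_measurable => [|[a a']]; first exact: countableP.
have [Sa|Sa] := pselect (S (a, a')).
  rewrite (_ : mkset _ = [set x | cell K x = a] `*` [set x | cell K x = a']).
    by apply: measurableX; exact: measurable_cell.
  apply/seteqP; split => [z [[<- <-] _]//|[x y] /= [ex ey]].
  by split=> //; rewrite /cell2 ex ey.
by rewrite (_ : mkset _ = set0)//; apply/seteqP; split => [z []|].
Qed.

Lemma measurable_fun_cell2 K (f : s.-tuple R * s.-tuple R -> R)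
    (phi : vec s * vec s -> R) : (forall z, f z = phi (cell2 K z)) ->
  measurable_fun [set: s.-tuple R * s.-tuple R] f.
Proof.
move=> fE _ A mA; rewrite setTI.
rewrite (_ : _ @^-1` _ = [set z | (phi @^-1` A) (cell2 K z)]).
  exact: measurable_cell2.
by apply/seteqP; split => z /=; rewrite fE.
Qed.

Lemma leb01_bfloor K (a : 'I_(b ^ K)) :
  leb01 [set x : R | bfloor b K x = a] = ((b ^ K)%:R^-1)%:E.
Proof.
rewrite /leb01 /mrestr.
(* The restriction to [0,1) removes the negative reals, which also have floor 0 and would enlarge
   the cell a = 0. *)
rewrite (_ : _ `&` _ = `[grid R b K a, grid R b K a.+1[%classic).
  rewrite lebesgue_measure_itv/= lte_fin /grid ltr_pM2r ?invr_gt0// ltr_nat ltnSn.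
  by rewrite -EFinB -mulrBl -natrB// subSnn mul1r natrX.
apply/seteqP; split => x /=; rewrite !in_itv/=.
  by move=> [/eqP e /andP[x0 _]]; rewrite (bfloor_eqP b_gt0) in e.
move=> /andP[ax xa].
have x0 : 0 <= x by rewrite (le_trans _ ax)// divr_ge0 ?ler0n// ltW.
split; first by apply/eqP; rewrite (bfloor_eqP b_gt0)// ax.
rewrite x0 (lt_le_trans xa)// ler_pdivrMr// mul1r -natrX ler_nat.
exact: ltn_ord.
Qed.

Lemma lebcube_cell K (f : {ffun 'I_s -> 'I_(b ^ K)}) :
  lebcube R s [set x | cell K x = vec_of f] = ((b ^ K)%:R^-1 ^+ s)%:E.
Proof.
rewrite (_ : mkset _ =
    [set x | forall j, [set u : R | bfloor b K u = f j] (tnth x j)]).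
  rewrite (lebcube_box (A := fun j => [set u : R | bfloor b K u = f j])) => [|j];
    last exact: measurable_bfloor.
  under eq_bigr do rewrite leb01_bfloor.
  by rewrite prodEFin prodr_const card_ord.
apply/seteqP; split => x /=.
  by move=> /cellP H j; rewrite H ffunE.
by move=> H; apply/cellP => j; rewrite ffunE.
Qed.

Lemma lebcube2_cell2 K (f g : {ffun 'I_s -> 'I_(b ^ K)}) :
  lebcube2 R s [set z | cell2 K z = (vec_of f, vec_of g)] =
  ((b ^ K)%:R^-1 ^+ 2 ^+ s)%:E.
Proof.
rewrite (_ : mkset _ =
    [set x | cell K x = vec_of f] `*` [set x | cell K x = vec_of g]).
  rewrite [LHS](product_measure1E (lebcube R s) (lebcube R s)).
  - transitivity (((b ^ K)%:R^-1 ^+ s : R)%:E * ((b ^ K)%:R^-1 ^+ s)%:E)%E.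
      by congr (_ * _)%E; exact: lebcube_cell.
    by rewrite -EFinM -expr2 exprAC.
  - exact: measurable_cell.
  - exact: measurable_cell.
by apply/seteqP; split => [z [<- <-]//|[x y] /= [<- <-]].
Qed.

End Cells.

(** * Integrals of functions constant on cells *)

Section CellIntegral.
Context (R : realType) (b s : nat) (b_gt0 : (0 < b)%N).
Local Notation T := (s.-tuple R * s.-tuple R)%type.
Local Notation mu := (lebcube2 R s).
Local Notation cell2 := (cell2 b).

Definition cube2 : set T := [set z | cube z.1 /\ cube z.2].

Lemma measurable_cube : measurable (cube (R := R) (s := s)).
Proof.
have -> : cube (R := R) (s := s) = \bigcap_(j in [set: 'I_s])
    (fun x : s.-tuple R => tnth x j) @^-1` `[0 : R, 1[%classic.
  apply/seteqP; split => [x H j _|x H j]; have := H j.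
    by rewrite /= in_itv.
  by rewrite /= in_itv; exact.
apply: fin_bigcap_measurable => // j _.
by rewrite -[X in measurable X]setTI; apply: measurable_tnth.
Qed.

Lemma cube2E : cube2 = cube (R := R) (s := s) `*` cube (R := R) (s := s).
Proof. by []. Qed.

Lemma measurable_cube2 : measurable cube2.
Proof. by rewrite cube2E; apply: measurableX; exact: measurable_cube. Qed.

Lemma lebcube_cube : lebcube R s (cube (R := R) (s := s)) = 1%E.
Proof.
transitivity (lebcube R s [set x | forall j, `[0 : R, 1[%classic (tnth x j)]).
  by congr (lebcube R s _); apply/seteqP; split => x H j; have := H j;
    rewrite /= in_itv.
rewrite (lebcube_box (A := fun=> `[0 : R, 1[%classic)) => [|//].
by rewrite big1// => j _; rewrite -leb01_setT /leb01 /mrestr setIid setTI.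
Qed.

Lemma ae_cube2 : {ae mu, forall z, cube2 z}.
Proof.
exists (~` cube2); split => //.
  by apply: measurableC; exact: measurable_cube2.
rewrite probability_setC; last exact: measurable_cube2.
rewrite cube2E (_ : mu _ = 1%E) ?subee//.
rewrite [LHS](product_measure1E (lebcube R s) (lebcube R s));
  [|exact: measurable_cube..].
transitivity (1 * 1 : \bar R)%E; last by rewrite mule1.
by congr (_ * _)%E; exact: lebcube_cube.
Qed.

Lemma cell_gridvec K (a : vec s) : cell b K (gridvec R b K a) = a.
Proof. by apply/cellP => j; rewrite tnth_mktuple bfloor_grid. Qed.

Lemma vec_of_inj N : injective (@vec_of s N).
Proof.
by move=> f g /ffunP e; apply/ffunP => j; apply/val_inj; have := e j; rewrite !ffunE.
Qed.

(** Up to a null set the space is the disjoint union D of finitely many cells of equal mass, and f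
    is constant on each. *)
Lemma integral_cell2 K (f : T -> R) (phi : vec s * vec s -> R) :
  (forall z, f z = phi (cell2 K z)) ->
  (\int[mu]_z (f z)%:E)%E =
  ((b ^ K)%:R^-1 ^+ 2 ^+ s * \sum_(u : {ffun 'I_s -> 'I_(b ^ K)})
     \sum_(v : {ffun 'I_s -> 'I_(b ^ K)}) phi (vec_of u, vec_of v))%:E.
Proof.
move=> fE.
pose C : Type := ({ffun 'I_s -> 'I_(b ^ K)} * {ffun 'I_s -> 'I_(b ^ K)})%type.
pose F (c : C) := [set z : T | cell2 K z = (vec_of c.1, vec_of c.2)].
pose D := \big[setU/set0]_(c <- enum {: C}) F c.
have mF c : measurable (F c) by exact: (measurable_cell2 b_gt0 K (fun y => y = _)).
have mD : measurable D by exact: bigsetU_measurable.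
have mf : measurable_fun [set: T] f by exact: (measurable_fun_cell2 b_gt0 fE).
have tF : trivIset [set` enum {: C}] F.
  move=> [u v] [u' v'] _ _ [z [/= e1]]; rewrite /F/= e1.
  by move=> [/vec_of_inj -> /vec_of_inj ->].
have -> : (\int[mu]_z (f z)%:E = \int[mu]_(z in D) (f z)%:E)%E.
  rewrite [RHS]integral_mkcond; apply: ae_eq_integral => //.
  - exact/measurable_EFinP.
  - apply/(measurable_restrictT _ mD)/measurable_EFinP.
    exact: measurable_funS mf.
  - apply: filterS ae_cube2 => z [c1 c2] _; rewrite patchE ifT//.
    apply/mem_set; rewrite /D -bigcup_seq.
    (* On the cube all floors are below b^K, hence every point of it lies in one of the cells that
       make up D. *)
    pose g (x : s.-tuple R) (cx : cube x) : {ffun 'I_s -> 'I_(b ^ K)} :=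
      [ffun j => Ordinal (bfloor_bound b_gt0 K (cx j))].
    exists (g _ c1, g _ c2); first by rewrite /= mem_enum.
    by congr (_, _); apply/ffunP => j; rewrite !ffunE.
rewrite (integral_bigsetU_EFin _ mF) ?enum_uniq//; last first.
  by apply/measurable_EFinP; exact: measurable_funS mf.
rewrite (eq_bigr (fun c : C => ((b ^ K)%:R^-1 ^+ 2 ^+ s *
    phi (vec_of c.1, vec_of c.2))%:E)) => [|c _].
  rewrite sumEFin big_enum/= -mulr_sumr pair_bigA/=.
  by congr (_ * _)%:E; apply: eq_bigr => -[].
rewrite (eq_integral (fun=> (phi (vec_of c.1, vec_of c.2))%:E)) => [|z].
  rewrite integral_cst// mulrC EFinM; congr (_ * _)%E.
  exact: lebcube2_cell2.
by rewrite inE => /= <-; rewrite fE.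
Qed.

Lemma complex_sumE (I : Type) (r : seq I) (P : pred I) (F : I -> R[i]) :
  \sum_(i <- r | P i) F i =
  Complex (\sum_(i <- r | P i) complex.Re (F i)) (\sum_(i <- r | P i) complex.Im (F i)).
Proof.
elim/big_rec3: _ => [//|i x y z _ ->].
by case: (F i).
Qed.

Definition factors_cell2 (U : Type) K (f : T -> U) :=
  forall z z', cell2 K z = cell2 K z' -> f z = f z'.

(** [gridvec] is a section of [cell], so f may be evaluated at the corner of the cell. *)
Lemma factors_cell2E U K (f : T -> U) z : factors_cell2 K f ->
  f z = f (gridvec R b K (cell2 K z).1, gridvec R b K (cell2 K z).2).
Proof. by apply; rewrite /cell2 /= !cell_gridvec. Qed.

Lemma Cintegral_cell2 K (f : T -> R[i]) : factors_cell2 K f ->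
  Cintegral mu f = (b ^ K)%:R^-1 ^+ 2 ^+ s *
    \sum_(u : {ffun 'I_s -> 'I_(b ^ K)}) \sum_(v : {ffun 'I_s -> 'I_(b ^ K)})
      f (gridvec R b K (vec_of u), gridvec R b K (vec_of v)).
Proof.
move=> Ff; rewrite /Cintegral /Rintegral.
pose phi c := f (gridvec R b K c.1, gridvec R b K c.2).
rewrite (@integral_cell2 K _ (fun c => complex.Re (phi c))) => [|z]; last first.
  by rewrite (factors_cell2E z Ff).
rewrite (@integral_cell2 K _ (fun c => complex.Im (phi c))) => [|z]; last first.
  by rewrite (factors_cell2E z Ff).
have -> : (b ^ K)%:R^-1 ^+ 2 ^+ s = ((((b ^ K)%:R^-1 ^+ 2 ^+ s : R)%:C)%C : R[i]).
  by rewrite 2!(rmorphXn (real_complex R)) (fmorphV (real_complex R))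
    (rmorph_nat (real_complex R)).
rewrite !pair_bigA/= complex_sumE /=.
apply/eqP; rewrite eq_complex/=; apply/andP; split.
  by rewrite mul0r subr0.
by rewrite mul0r addr0.
Qed.

End CellIntegral.

(** * Uniform densities on the sets D_i and their finite mixtures *)

Section Mixture.
Context (R : realType) (b s : nat) (b_prime : prime b).
Local Notation T := (s.-tuple R * s.-tuple R)%type.
Local Notation mu := (lebcube2 R s).
Local Notation cell2 := (cell2 b).
Local Notation density := (@split_density_vec R b s).
Implicit Types (i l : vec s) (z : T).

Let b_gt0 : (0 < b)%N. Proof. exact: prime_gt0. Qed.
Let b_gt1 : (1 < b)%N. Proof. exact: prime_gt1. Qed.

Lemma eq_cell K (x x' : s.-tuple R) j : cell b K x = cell b K x' ->
  bfloor b K (tnth x j) = bfloor b K (tnth x' j).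
Proof. by move=> /ffunP/(_ j); rewrite !ffunE. Qed.

Lemma factors_density K i : (forall j, i j < K)%N ->
  factors_cell2 b K (density i).
Proof.
move=> iK [x y] [x' y'] [ex ey]; apply: eq_bigr => j _ /=.
rewrite /split_density.
by rewrite (eq_first_split b_gt0 (iK j) (eq_cell j ex) (eq_cell j ey)).
Qed.

Lemma factors_wal1 K l : (forall j, l j < b ^ K)%N ->
  factors_cell2 b K (fun z => wal b l z.1).
Proof.
move=> lK [x y] [x' y'] [ex _]; apply: eq_bigr => j _ /=.
by rewrite (eq_wal1 b_gt0 _ (eq_cell j ex))// ndigits_leq.
Qed.

Lemma factors_wal2 K l : (forall j, l j < b ^ K)%N ->
  factors_cell2 b K (fun z => wal b l z.2).
Proof.
move=> lK [x y] [x' y'] [_ ey]; apply: eq_bigr => j _ /=.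
by rewrite (eq_wal1 b_gt0 _ (eq_cell j ey))// ndigits_leq.
Qed.

Lemma measurable_factors K (f : T -> R) : factors_cell2 b K f ->
  measurable_fun [set: T] f.
Proof.
move=> Ff; apply: (measurable_fun_cell2 b_gt0 (K := K)
  (phi := fun c => f (gridvec R b K c.1, gridvec R b K c.2))) => z.
exact: (factors_cell2E b_gt0).
Qed.

Lemma density_ge0 i z : 0 <= density i z.
Proof.
apply: prodr_ge0 => j _; rewrite /split_density; case: ifP => // _.
by rewrite divr_ge0 ?exprn_ge0 ?ler0n// subr_ge0 ler1n.
Qed.

(** The constant value of the density on D_i; it turns out in [height_Dset] to be the reciprocal of
    the measure of D_i. *)
Let height i : R := \prod_j (b%:R ^+ (i j).+1 / (b%:R - 1)).

Let height_gt0 i : 0 < height i.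
Proof.
apply: prodr_gt0 => j _.
by rewrite divr_gt0 ?exprn_gt0 ?ltr0n// subr_gt0 ltr1n.
Qed.

Lemma DsetE i z : cube2 z ->
  Dset b i z <-> forall j, first_split b (tnth z.1 j) (tnth z.2 j) (i j).
Proof.
move=> [c1 c2]; split => [[_ _ H] j|H]; first exact/gammaP.
by split => // j; exact/gammaP.
Qed.

Lemma density_Dset i z : cube2 z -> density i z = height i * \1_(Dset b i) z.
Proof.
move=> cz; rewrite indicE; have [/set_mem Dz|nD] := boolP (z \in Dset b i).
  rewrite mulr1; apply: eq_bigr => j _.
  by rewrite /split_density ((DsetE i cz).1 Dz).
rewrite mulr0; move: nD; rewrite notin_setE => /(contra_not (DsetE i cz).2).
move=> /existsNP[j /negP nj].
by rewrite /split_density_vec (bigD1 j)//= /split_density (negPf nj) mul0r.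
Qed.

(** A level exceeding every entry of i, fine enough for the density to be constant on cells. *)
Let bound_vec i := (\sum_j i j).+1.

Let lt_bound_vec i j : (i j < bound_vec i)%N.
Proof. by rewrite ltnS (bigD1 j)//= leq_addr. Qed.

Lemma measurable_density i : measurable_fun [set: T] (density i).
Proof. by apply: measurable_factors; exact: (factors_density (lt_bound_vec i)). Qed.

(** Inside the cube, D_i is the set where the density is positive. *)
Lemma measurable_Dset i : measurable (Dset b i : set T).
Proof.
have -> : (Dset b i : set T) = @cube2 R s `&` (density i @^-1` `]0, +oo[%classic).
  apply/seteqP; split => z.
    move=> Dz; have cz : cube2 z by case: Dz.
    split=> //=; rewrite in_itv/= andbT density_Dset// indicE mem_set// mulr1.
    exact: height_gt0.
  move=> [cz /=]; rewrite in_itv/= andbT density_Dset// indicE.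
  by case: (boolP (z \in _)) => [/set_mem//|_]; rewrite mulr0 ltxx.
apply: measurableI; first exact: measurable_cube2.
rewrite -[X in measurable X]setTI; apply: measurable_density => //.
Qed.

(** The total mass is the coefficient at l = l' = 0, so the complex grid sum already computed gives
    it through the injectivity of the embedding of the reals. *)
Lemma integral_density_setT i : (\int[mu]_z (density i z)%:E = 1)%E.
Proof.
set K := bound_vec i.
rewrite (integral_cell2 b_gt0 (K := K) (phi :=
  fun c => density i (gridvec R b K c.1, gridvec R b K c.2))) => [|z]; last first.
  exact: (factors_cell2E b_gt0 z (factors_density (lt_bound_vec i))).
congr EFin.
rewrite [X in _ * X](_ : _ = (b ^ K)%:R ^+ 2 ^+ s).
  rewrite -!exprMn mulVf ?expr1n// pnatr_eq0 -lt0n expn_gt0 b_gt0//.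
apply: complexI.
have bK_gt0 : (0 < b ^ K)%N by rewrite expn_gt0 b_gt0.
have z0 j : ((zvec : vec s) j < b ^ K)%N by rewrite ffunE.
have := sum_split_density_vec R b_prime (lt_bound_vec i) z0 z0.
rewrite eqxx split_coef_vec0// !mulr1 => E.
rewrite rmorph_sum 2!(rmorphXn (real_complex R)) (rmorph_nat (real_complex R)).
rewrite -[RHS]E; apply: eq_bigr => u _; rewrite rmorph_sum; apply: eq_bigr => v _.
by rewrite !wal_0 conjc1 !mulr1.
Qed.

Lemma integral_density i (A : set T) : measurable A ->
  (\int[mu]_(z in A) (density i z)%:E = (height i)%:E * mu (A `&` Dset b i))%E.
Proof.
move=> mA; have mD := measurable_Dset i.
rewrite (ae_eq_integral (fun z => ((height i)%:E * (\1_(Dset b i) z)%:E)%E))//.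
- rewrite ge0_integralZl//.
  + by rewrite integral_indic// setIC.
  + by apply/measurable_EFinP; exact: measurable_funTS.
  + by rewrite lee_fin ltW.
- apply/measurable_EFinP; apply: measurable_funTS; exact: measurable_density.
- apply: emeasurable_funM; first exact: measurable_cst.
  by apply/measurable_EFinP; exact: measurable_funTS.
- apply: filterS (ae_cube2 R s) => z cz _.
  by rewrite density_Dset// EFinM.
Qed.

Lemma fin_num_lebcube2 (A : set T) : measurable A -> mu A \is a fin_num.
Proof. exact: fin_num_measure. Qed.

Let height_Dset i : height i * fine (mu (Dset b i)) = 1.
Proof.
have := congr1 fine (integral_density i measurableT).
rewrite setTI integral_density_setT fineM//.
exact: fin_num_lebcube2 (measurable_Dset i).
Qed.

Lemma lebcube2_Dset_neq0 i : fine (mu (Dset b i)) != 0.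
Proof.
apply/eqP => e; have := height_Dset i.
by rewrite e mulr0 => /esym/eqP; rewrite oner_eq0.
Qed.

Lemma integral_density_uniform i (A : set T) : measurable A ->
  (\int[mu]_(z in A) (density i z)%:E =
   (fine (mu (A `&` Dset b i)) / fine (mu (Dset b i)))%:E)%E.
Proof.
move=> mA; rewrite integral_density//.
have fAD : mu (A `&` Dset b i) \is a fin_num.
  by apply: fin_num_lebcube2; apply: measurableI => //; exact: measurable_Dset.
rewrite -(fineK fAD) -EFinM mulrC; congr (_ * _)%:E.
have h0 := lebcube2_Dset_neq0 i.
by apply: (mulIf h0); rewrite mulVf// height_Dset.
Qed.

Context (I : finType) (Q : pred I) (c : R) (g : I -> vec s).

Definition mix_density z : R := c * \sum_(p | Q p) density (g p) z.

Definition mix_coef l : R := c * \sum_(p | Q p) split_coef_vec R b (g p) l.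

Lemma factors_mix_density K : (forall p j, Q p -> g p j < K)%N ->
  factors_cell2 b K mix_density.
Proof.
move=> gK z z' e; congr (_ * _); apply: eq_bigr => p Qp.
by apply: factors_density e => j; exact: gK.
Qed.

Lemma measurable_mix_density : measurable_fun [set: T] mix_density.
Proof.
have -> : mix_density =
    fun z => c * \sum_(p <- [seq p <- index_enum I | Q p]) density (g p) z.
  by apply/funext => z; rewrite big_filter.
apply: measurable_funM => //; apply: measurable_sum => p.
exact: measurable_density.
Qed.

Lemma mix_density_walsh N z : (forall p j, Q p -> g p j < N)%N -> cube2 z ->
  ((mix_density z)%:C)%C =
  \sum_(f : {ffun 'I_s -> 'I_(b ^ N)})
    ((mix_coef (vec_of f))%:C)%C * wal b (vec_of f) z.1 * conjc (wal b (vec_of f) z.2).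
Proof.
move=> gN [c1 c2].
rewrite rmorphM rmorph_sum/= (eq_bigr (fun p => \sum_(f : {ffun 'I_s -> 'I_(b ^ N)})
    ((split_coef_vec R b (g p) (vec_of f))%:C)%C *
      wal b (vec_of f) z.1 * conjc (wal b (vec_of f) z.2))) => [|p Qp]; last first.
  by rewrite -split_density_vec_walsh -?surjective_pairing// => j; exact: gN.
rewrite exchange_big/= mulr_sumr; apply: eq_bigr => f _.
by rewrite -!mulr_suml rmorphM rmorph_sum/= !mulrA.
Qed.

Lemma walsh_coef_mix l l' :
  walsh_coef b mix_density l l' = (l == l')%:R * ((mix_coef l)%:C)%C.
Proof.
(* A level so fine that all the densities of the mixture and both Walsh functions are constant on
   its cells. *)
pose K := (\sum_(p | Q p) \sum_j (g p j).+1 +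
  (\sum_j ndigits b (l j) + \sum_j ndigits b (l' j)))%N.
have gK p j : Q p -> (g p j < K)%N.
  move=> Qp; apply: leq_trans (leq_addr _ _).
  by rewrite (bigD1 p)//= (bigD1 j)//= -addnA leq_addr.
have lK j : (l j < b ^ K)%N.
  rewrite -ndigits_leq// (leq_trans _ (leq_addl _ _))//.
  by rewrite (leq_trans _ (leq_addr _ _))// (bigD1 j)//= leq_addr.
have l'K j : (l' j < b ^ K)%N.
  rewrite -ndigits_leq// (leq_trans _ (leq_addl _ _))//.
  by rewrite (leq_trans _ (leq_addl _ _))// (bigD1 j)//= leq_addr.
rewrite /walsh_coef (Cintegral_cell2 b_gt0 (K := K)); last first.
  move=> z z' e; rewrite (factors_mix_density gK e).
  by rewrite (factors_wal1 lK e) (factors_wal2 l'K e).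
under eq_bigr => u _ do under eq_bigr => v _ do
  rewrite /mix_density rmorphM rmorph_sum/= mulr_sumr !mulr_suml.
under eq_bigr => u _ do rewrite exchange_big/=.
rewrite exchange_big/=.
rewrite (eq_bigr (fun p => c%:C%C * ((b ^ K)%:R ^+ 2 ^+ s *
    ((l == l')%:R * (split_coef_vec R b (g p) l)%:C%C)))) => [|p Qp]; last first.
  rewrite -(sum_split_density_vec R b_prime (fun j => gK p j Qp) lK l'K).
  rewrite mulr_sumr; apply: eq_bigr => u _; rewrite mulr_sumr; apply: eq_bigr => v _.
  by rewrite !mulrA.
rewrite -mulr_sumr -mulr_sumr -mulr_sumr /mix_coef rmorphM rmorph_sum/=.
rewrite [LHS]mulrCA [X in _ * X]mulrA -!exprMn mulVf ?expr1n ?mul1r; last first.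
  by rewrite pnatr_eq0 -lt0n expn_gt0 b_gt0.
by rewrite mulrCA.
Qed.

Lemma walsh_coef_ae (psi h : T -> R) l l' : measurable_fun [set: T] psi ->
  measurable_fun [set: T] h -> {ae mu, forall z, psi z = h z} ->
  walsh_coef b psi l l' = walsh_coef b h l l'.
Proof.
move=> mpsi mh psih.
pose K := (\sum_j ndigits b (l j) + \sum_j ndigits b (l' j))%N.
have lK j : (l j < b ^ K)%N.
  rewrite -ndigits_leq//.
  by rewrite (leq_trans _ (leq_addr _ _))// (bigD1 j)//= leq_addr.
have l'K j : (l' j < b ^ K)%N.
  rewrite -ndigits_leq//.
  by rewrite (leq_trans _ (leq_addl _ _))// (bigD1 j)//= leq_addr.
pose w z := conjc (wal b l z.1) * wal b l' z.2.
have Fw : factors_cell2 b K w.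
  by move=> z z' e; rewrite /w (factors_wal1 lK e) (factors_wal2 l'K e).
have mRe : measurable_fun [set: T] (fun z => complex.Re (w z)).
  by apply: (measurable_factors (K := K)) => z z' e /=; rewrite (Fw _ _ e).
have mIm : measurable_fun [set: T] (fun z => complex.Im (w z)).
  by apply: (measurable_factors (K := K)) => z z' e /=; rewrite (Fw _ _ e).
(* As f is real, the two components of [Cintegral] are real integrals of f against the real and
   imaginary parts of w, to which almost everywhere equality applies. *)
have scalE (f : T -> R) : (fun z => (f z)%:C%C * conjc (wal b l z.1) * wal b l' z.2) =
    (fun z => Complex (f z * complex.Re (w z)) (f z * complex.Im (w z))).
  apply/funext => z; rewrite -mulrA /=; rewrite -/(w z); case: (w z) => u v.
  by apply/eqP; rewrite eq_complex/= !mul0r subr0 addr0 !eqxx.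
have intE (q : T -> R) : measurable_fun [set: T] q ->
    (\int[mu]_z (psi z * q z) = \int[mu]_z (h z * q z)).
  move=> mq; congr fine; apply: ae_eq_integral => //.
  - by apply/measurable_EFinP; exact: measurable_funM.
  - by apply/measurable_EFinP; exact: measurable_funM.
  - by apply: filterS psih => z e _; rewrite e.
by rewrite /walsh_coef (scalE psi) (scalE h) /Cintegral/= (intE _ mRe) (intE _ mIm).
Qed.

End Mixture.

(** * Coefficients as alternating sums of counting indicators *)

Section CountingFormula.
Context (R : realType) (b s : nat) (b_prime : prime b).
Implicit Types (g l k : vec s) (e r : bvec s).

Let b_gt1 : (1 < b)%N. Proof. exact: prime_gt1. Qed.

(** For l > 0 with k digits the left side is b / (b - 1) times [k <= i] - b^-1 [k - 1 <= i], which
    is 1, -1 / (b - 1) or 0 according to whether i >= k, i = k - 1 or i < k - 1. For l = 0 only e =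
    0 survives. *)
Lemma split_coef_digits (i l : nat) :
  (b%:R / (b%:R - 1)) ^+ (0 < l)%N *
    \sum_(e : bool) (e <= (0 < l)%N)%N%:R * ((-1) ^+ e * b%:R ^- e) *
      (ndigits b l - e <= i)%N%:R = split_coef R b i l :> R.
Proof.
have b0 : b%:R != 0 :> R by rewrite pnatr_eq0 -lt0n ltnW.
have b1 : b%:R - 1 != 0 :> R by rewrite subr_eq0 pnatr_eq1 gtn_eqF.
rewrite big_bool /= subn0 /split_coef -!ndigits_leq// !expr0 !expr1 invr1 !mulr1.
case: l => [|l] /=.
  by rewrite expr0 !mul0r add0r !mul1r.
rewrite expr1 leq_subLR add1n !mul1r.
have [h|h] := leqP (ndigits b l.+1) i.
  by rewrite (leq_trans h)//= !mulr1; field; rewrite b0.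
by case: leqP => h' /=; rewrite ?mulr1 ?mulr0 ?addr0//; field; rewrite ?b0 ?b1.
Qed.

Lemma split_coef_vec_digits g l :
  (b%:R / (b%:R - 1)) ^+ bsum (supp l) *
    \sum_(e | le_bvec e (supp l)) (-1) ^+ bsum e * b%:R ^- bsum e *
      [forall j, (sub_vec (digit_lengths b l) e) j <= g j]%N%:R =
  split_coef_vec R b g l :> R.
Proof.
rewrite /split_coef_vec.
under [RHS]eq_bigr => j _ do rewrite -split_coef_digits.
have forall_prod (p : pred 'I_s) : [forall j, p j]%:R = \prod_j (p j)%:R :> R.
  have [/forallP pT|/forallPn[j /negPf pj]] := boolP [forall j, p j].
    by rewrite big1// => j _; rewrite pT.
  by rewrite (bigD1 j)//= pj mul0r.
rewrite big_split/= prodrXr; congr (_ * _).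
  by congr (_ ^+ _); apply: eq_bigr => j _; rewrite ffunE.
(* Expanding the product of two-term sums, one choice of e_j in each coordinate makes up e; the
   first indicators multiply to the condition e <= supp(l). *)
rewrite bigA_distr_bigA [LHS]big_mkcond/=; apply: eq_bigr => e _.
rewrite !big_split/= -forall_prod (_ : [forall j, _] = le_bvec e (supp l)); last first.
  by apply: eq_forallb => j; rewrite ffunE.
case: ifP => _; rewrite ?mul0r// mul1r prodrXr prodfV prodrXr forall_prod.
by congr (_ * _); apply: eq_bigr => j _; rewrite !ffunE.
Qed.

End CountingFormula.

(** * Probabilities under a mixture *)

Section MixtureLaw.
Context (R : realType) (b s : nat) (b_prime : prime b).
Local Notation T := (s.-tuple R * s.-tuple R)%type.
Local Notation mu := (lebcube2 R s).
Context (I : finType) (Q : pred I) (c : R) (g : I -> vec s).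

Lemma integral_mix_density (A : set T) : 0 <= c -> measurable A ->
  (\int[mu]_(z in A) (mix_density b Q c g z)%:E = (c * \sum_(p | Q p)
   (fine (mu (A `&` Dset b (g p))) / fine (mu (Dset b (g p)))))%:E)%E.
Proof.
move=> c0 mA.
have mden i : measurable_fun A (EFin \o @split_density_vec R b s i).
  apply/measurable_EFinP; apply: measurable_funTS; exact: measurable_density.
have mixE z : (mix_density b Q c g z)%:E =
    (c%:E * \sum_(p <- [seq p <- index_enum I | Q p])
      (split_density_vec b (g p) z)%:E)%E.
  by rewrite sumEFin big_filter EFinM.
under eq_integral do rewrite mixE.
rewrite ge0_integralZl//; last first.
- by move=> z _; apply: sume_ge0 => p _; rewrite lee_fin density_ge0.
- by apply: emeasurable_sum => p; exact: mden.
rewrite ge0_integral_sum//; last by move=> p z _; rewrite lee_fin density_ge0.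
rewrite big_filter; under eq_bigr => p _ do rewrite (integral_density_uniform b_prime _ mA).
  by rewrite sumEFin -EFinM.
by move=> p; exact: mden.
Qed.

End MixtureLaw.

(** * Common digits of distinct points of the net *)

Section NetPairs.
Context (R : realType) (b m s : nat) (b_prime : prime b).
Context (V : 'I_(b ^ m) -> s.-tuple R).
Context (V_proj : forall j : 'I_s, is_net b 0 m (projection j V)).

Let b_gt0 : (0 < b)%N. Proof. exact: prime_gt0. Qed.

Lemma net_cube i : cube (V i).
Proof.
move=> j; have [/(_ i) + _] := V_proj j => /(_ ord0).
by rewrite tnth0.
Qed.

(** In a (0,m,1)-net every interval of length b^-m holds exactly b^0 = 1 point, counted by index, so
    two indices cannot share one. *)
Lemma net_bfloor_inj j : injective (fun i => bfloor b m (tnth (V i) j)).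
Proof.
move=> i i' e; apply/eqP; apply: contraT => ii'.
have [_ /(_ [ffun=> m])] := V_proj j.
rewrite big_ord1 ffunE subn0 leqnn => /(_ isT).
move=> /(_ [ffun=> bfloor b m (tnth (V i) j)]).
have Vm : forall k : 'I_1, ([ffun=> bfloor b m (tnth (V i) j)] k <
    b ^ [ffun=> m] k)%N.
  by move=> k; rewrite !ffunE bfloor_bound// net_cube.
move=> /(_ Vm); rewrite big_ord1 ffunE subrr expr0z => /eqP.
rewrite pnatr_eq1 => /eqP card1.
have : (2 <= #|[set i; i']%SET|)%N by rewrite cards2 ii'.
suff /subset_leq_card : [set i; i']%SET \subset
    [pred k | elem_interval b [ffun=> m] [ffun=> bfloor b m (tnth (V i) j)]
      (projection j V k)].
  by rewrite card1 => h /leq_trans/(_ h).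
apply/fintype.subsetP => k; rewrite in_set2 => kii'; rewrite inE.
have Vk : bfloor b m (tnth (V k) j) = bfloor b m (tnth (V i) j).
  by case/orP: kii' => /eqP ->.
apply/forallP => k0; rewrite !ffunE (ord1 k0) tnth0 -Vk.
rewrite -/(grid R b m _) -/(grid R b m _) -bfloor_eqP ?eqxx//.
by have /andP[] := net_cube k j.
Qed.

(** The default 0 stands for infinitely many common digits, which [pair_gammaP] excludes for
    distinct indices. *)
Definition pair_gamma (p : 'I_(b ^ m) * 'I_(b ^ m)) : vec s :=
  [ffun j => odflt 0%N (gamma b (tnth (V p.1) j) (tnth (V p.2) j))].

Lemma pair_gammaP p : p.1 != p.2 -> forall j, (pair_gamma p j < m)%N /\
  gamma b (tnth (V p.1) j) (tnth (V p.2) j) = Some (pair_gamma p j).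
Proof.
move=> pp j.
have e0 : bfloor b 0 (tnth (V p.1) j) = bfloor b 0 (tnth (V p.2) j).
  by rewrite !bfloor0// net_cube.
have [|i im gi] := gamma_lt b_gt0 e0 (K := m).
  by apply: contra pp => /eqP/net_bfloor_inj ->.
by rewrite /pair_gamma ffunE gi.
Qed.

Lemma pair_gamma_Dset p : p.1 != p.2 -> Dset b (pair_gamma p) (V p.1, V p.2).
Proof.
move=> pp; split; [exact: net_cube..|].
by move=> j; have [] := pair_gammaP pp j.
Qed.

End NetPairs.

(** * The law of a randomly chosen pair *)

Section JointLaw.
Context (R : realType) d (Omega : measurableType d) (P : probability Omega R).
Context (s n : nat).
Context (U : 'I_n -> {RV P >-> s.-tuple R}) (I J : Omega -> 'I_n).

(** Each U_i is measurable for the sigma-algebra the family generates, hence so is a pair; this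
    makes independence of (I, J) applicable to events about two points. *)
Lemma g_sigma_preimage_pair (l j : 'I_n) (A : set (s.-tuple R * s.-tuple R)) :
  measurable A ->
  g_sigma_preimage (fun i => U i : Omega -> s.-tuple R) [set w | A (U l w, U j w)].
Proof.
move=> mA.
pose G : set (set Omega) := \big[setU/set0]_(i < n)
  preimage_set_system [set: Omega] (U i) measurable.
have mU i : measurable_fun [set: g_sigma_algebraType G] (U i).
  move=> _ B mB; apply: sub_gen_smallest.
  by rewrite /G (bigD1 i)//=; left; exists B.
have := measurable_fun_pair (mU l) (mU j) measurableT mA.
by rewrite setTI.
Qed.

(** Total probability over the values of (I, J), with independence applied to each term. *)
Lemma pair_law (A : set (s.-tuple R * s.-tuple R)) :
  random_distinct_pair U I J -> measurable A ->
  P [set w | A (U (I w) w, U (J w) w)] =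
  (\sum_(p : 'I_n * 'I_n | p.1 != p.2)
    ((n%:R * (n%:R - 1))^-1)%:E * P [set w | A (U p.1 w, U p.2 w)])%E.
Proof.
move=> [mIJ PIJ indep] mA.
pose F (p : 'I_n * 'I_n) := [set w | I w = p.1 /\ J w = p.2] `&`
  [set w | A (U p.1 w, U p.2 w)].
have mAU l j : measurable [set w | A (U l w, U j w)].
  rewrite -[X in measurable X]setTI.
  by apply: (measurable_fun_pair _ _ measurableT mA); exact: measurable_funPT.
have -> : [set w | A (U (I w) w, U (J w) w)] = \bigcup_(p in setT) F p.
  apply/seteqP; split => [w Aw|w [p _ [[/= -> ->]]]//].
  by exists (I w, J w).
rewrite (measure_fin_bigcup _ finite_finset); last 2 first.
- by move=> p p' _ _ [w [[[e1 e2] _] [[e1' e2'] _]]];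
    rewrite (surjective_pairing p) (surjective_pairing p') -e1 -e2 e1' e2'.
- by move=> p _; apply: measurableI => //; exact: mIJ.
rewrite (fsbigE (index_enum _)) ?index_enum_uniq//; last first.
  by move=> p _; rewrite mem_index_enum.
rewrite [RHS]big_mkcond/= big_mkcond/=; apply: eq_bigr => p _.
rewrite mem_set// indep; last exact: g_sigma_preimage_pair.
by rewrite PIJ; case: eqP => //= _; rewrite mul0e.
Qed.

End JointLaw.

(** Once a finite index set contains r, its partial sum is exactly the sum over r, so r itself
    serves for every epsilon. *)
Lemma has_sum_finsupp (C : numDomainType) (I : choiceType) (D : pred I)
    (f : I -> C) (r : seq I) : uniq r ->
  (forall i, D i -> i \notin r -> f i = 0) ->
  has_sum D f (\sum_(i <- r | D i) f i).
Proof.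
move=> ur f0 eps eps0; exists [fset i in r]%fset => F rF.
suff -> : \sum_(i <- F | D i) f i = \sum_(i <- r | D i) f i.
  by rewrite subrr normr0.
rewrite (bigID (mem r))/= [X in _ + X]big1 ?addr0; last first.
  by move=> i /andP[]; exact: f0.
rewrite (eq_bigl (fun i => (i \in r) && D i)); last by move=> i; rewrite andbC.
rewrite -big_filter_cond; apply: perm_big; apply: uniq_perm => //.
  by rewrite filter_uniq.
move=> i; rewrite mem_filter andbC; case: (boolP (i \in r)) => ir; last by rewrite andbF.
by rewrite andbT; apply: (fsubsetP rF); rewrite !inE.
Qed.

(** * The explicit joint density of a scrambled net *)

Section PairDensity.
Context (R : realType) d (Omega : measurableType d) (P : probability Omega R).
Context (b m s : nat) (b_prime : prime b) (m_ge1 : (1 <= m)%N).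
Context (V : 'I_(b ^ m) -> s.-tuple R).
Context (V_proj : forall j : 'I_s, is_net b 0 m (projection j V)).
Context (U : 'I_(b ^ m) -> {RV P >-> s.-tuple R}).
Context (VU : scrambling b V U).
Local Notation T := (s.-tuple R * s.-tuple R)%type.
Local Notation mu := (lebcube2 R s).
Local Notation n := ((b ^ m)%:R : R).

Let b_gt1 : (1 < b)%N. Proof. exact: prime_gt1. Qed.

Let n_gt1 : (1 < b ^ m)%N.
Proof. by rewrite -(expn0 b) ltn_exp2l. Qed.

Definition distinct_pair : pred ('I_(b ^ m) * 'I_(b ^ m)) := fun p => p.1 != p.2.

Definition pair_density : T -> R :=
  mix_density b distinct_pair (n * (n - 1))^-1 (pair_gamma V).

Definition pair_coef : vec s -> R :=
  mix_coef b distinct_pair (n * (n - 1))^-1 (pair_gamma V).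

Let c_ge0 : 0 <= (n * (n - 1))^-1.
Proof. by rewrite invr_ge0 mulr_ge0// subr_ge0 ler1n ltnW. Qed.

Let gm p j : distinct_pair p -> (pair_gamma V p j < m)%N.
Proof. by move=> pp; have [] := pair_gammaP b_prime V_proj pp j. Qed.

(** There are n (n - 1) ordered pairs of distinct indices and each contributes coefficient 1. *)
Lemma pair_coef0 : pair_coef zvec = 1.
Proof.
rewrite /pair_coef /mix_coef (eq_bigr (fun=> 1)) => [|p _]; last first.
  exact: split_coef_vec0.
rewrite (_ : \sum_(p | _) 1 = n * (n - 1)) ?mulVf//.
  by rewrite mulf_neq0 ?subr_eq0 ?pnatr_eq1 ?pnatr_eq0 ?gtn_eqF// ltnW.
rewrite -(pair_big_dep xpredT (fun i j => i != j) (fun _ _ => 1))/=.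
rewrite (eq_bigr (fun=> n - 1)) => [|i _].
  by rewrite sumr_const card_ord mulr_natl.
rewrite sumr_const (eq_card (B := predC1 i)); last by move=> j; rewrite !inE eq_sym.
by rewrite cardC1 card_ord -subn1 natrB// ltnW.
Qed.

(** Common-digit counts i are below m, so i + 1 <= m and the coordinate coefficient vanishes from
    b^m on; this makes the Walsh series finite. *)
Lemma pair_coef_supp (l : vec s) : (exists j, b ^ m <= l j)%N -> pair_coef l = 0.
Proof.
move=> [j lj]; rewrite /pair_coef /mix_coef big1 ?mulr0// => p pp.
rewrite /split_coef_vec (bigD1 j)//= /split_coef.
have h i : (i <= m)%N -> (l j < b ^ i)%N = false.
  by move=> im; rewrite ltnNge (leq_trans _ lj)// leq_exp2l.
by rewrite !h ?mul0r ?gm// ltnW// gm.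
Qed.

Lemma pair_density_law (I J : Omega -> 'I_(b ^ m)) (A : set T) :
  random_distinct_pair U I J -> measurable A ->
  P [set w | A (U (I w) w, U (J w) w)] =
  (\int[mu]_(z in A) (pair_density z)%:E)%E.
Proof.
move=> IJ mA; rewrite (pair_law IJ mA) integral_mix_density//.
rewrite mulr_sumr -sumEFin; apply: eq_bigr => p pp.
by rewrite (VU.2 _ _ _ pp (pair_gamma_Dset b_prime V_proj pp) _ mA) -EFinM.
Qed.

(** Both functions integrate to the law of the random pair over every measurable set, so they agree
    almost everywhere. *)
Lemma pair_density_ae (I J : Omega -> 'I_(b ^ m)) (psi : T -> R) :
  random_distinct_pair U I J -> joint_pdf U I J psi ->
  {ae mu, forall z, psi z = pair_density z}.
Proof.
move=> IJ [mpsi psi_ge0 psiE].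
have mEpsi : measurable_fun [set: T] (EFin \o psi) by exact/measurable_EFinP.
have : ae_eq mu setT (EFin \o psi) (EFin \o pair_density).
  apply: integral_ae_eq => //.
  (* The integral of the nonnegative [psi] is the probability of the whole space, namely 1. *)
  - apply/integrableP; split => //.
    rewrite (eq_integral (EFin \o psi)) => [|z _].
      rewrite -psiE//.
      have -> : P [set w | [set: T] (U (I w) w, U (J w) w)] = 1%E.
        by rewrite -(probability_setT P); congr (P _); apply/seteqP; split.
      exact: ltry.
    by rewrite /= ger0_norm.
  - apply/measurable_EFinP; exact: measurable_mix_density.
  - by move=> A _ mA; rewrite -psiE// (pair_density_law IJ).
by apply: filterS => z h; have [] := h Logic.I.
Qed.

(** A uniform law on D_i gives D_i probability 1, and finitely many pairs produce finitely many null
    events. Scrambling thus preserves common-digit vectors almost surely. *)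
Lemma ae_pair_gamma : {ae P, forall w, forall p, distinct_pair p ->
  Dset b (pair_gamma V p) (U p.1 w, U p.2 w)}.
Proof.
apply: filter_forall => p.
have [pp|npp] := boolP (distinct_pair p); last by apply: aeW => w.
have mD := @measurable_Dset R b s b_prime (pair_gamma V p).
have mU : measurable [set w | Dset b (pair_gamma V p) (U p.1 w, U p.2 w)].
  rewrite -[X in measurable X]setTI.
  by apply: (measurable_fun_pair _ _ measurableT mD); exact: measurable_funPT.
exists (~` [set w | Dset b (pair_gamma V p) (U p.1 w, U p.2 w)]); split.
- exact: measurableC.
- rewrite probability_setC//.
  rewrite (VU.2 _ _ _ pp (pair_gamma_Dset b_prime V_proj pp) _ mD) setIid.
  by rewrite divff ?subee// lebcube2_Dset_neq0.
- by move=> w /= h h'; apply: h.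
Qed.

Lemma Mcount_pairE (k : vec s) (W : 'I_(b ^ m) -> s.-tuple R) :
  (forall p, distinct_pair p -> Dset b (pair_gamma V p) (W p.1, W p.2)) ->
  (Mcount b k W)%:R =
  \sum_(p | distinct_pair p) [forall j, k j <= pair_gamma V p j]%N%:R :> R.
Proof.
move=> DW; rewrite /Mcount -sum1_card natr_sum big_mkcondr/=.
apply: eq_bigr => p pp; rewrite (eq_forallb (P2 := fun j => (k j <= pair_gamma V p j)%N)).
  by case: [forall j, _].
by move=> j; have [_ _ ->] := DW p pp.
Qed.

(** Exchanging the sums over pairs and over e turns the indicators into counting numbers. W stands
    for a realization of the scrambled points outside the null event. *)
Lemma pair_coefE (l : vec s) (W : 'I_(b ^ m) -> s.-tuple R) :
  (forall p, distinct_pair p -> Dset b (pair_gamma V p) (W p.1, W p.2)) ->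
  pair_coef l = (n * (n - 1))^-1 * (b%:R / (b%:R - 1)) ^+ bsum (supp l) *
    \sum_(e : bvec s | le_bvec e (supp l)) (-1) ^+ bsum e * b%:R ^- bsum e *
      (Mcount b (sub_vec (digit_lengths b l) e) W)%:R.
Proof.
move=> DW; rewrite /pair_coef /mix_coef -mulrA; congr (_ * _).
under [in RHS]eq_bigr do rewrite (Mcount_pairE _ DW) mulr_sumr.
rewrite exchange_big mulr_sumr/=; apply: eq_bigr => p _.
by rewrite -split_coef_vec_digits.
Qed.

Lemma pair_density_has_sum z : cube2 z ->
  exists2 S : R[i], has_sum (fun l : vec s => l != zvec)
    (fun l => (pair_coef l)%:C%C * wal b l z.1 * conjc (wal b l z.2)) S &
    (pair_density z)%:C%C = 1 + S.
Proof.
move=> cz.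
pose r := [seq vec_of f | f <- enum {ffun 'I_s -> 'I_(b ^ m)}].
exists (\sum_(l <- r | l != zvec)
  (pair_coef l)%:C%C * wal b l z.1 * conjc (wal b l z.2)).
  apply: has_sum_finsupp.
    by rewrite map_inj_uniq ?enum_uniq//; exact: vec_of_inj.
  move=> l _ lr; rewrite pair_coef_supp ?mul0r//.
  have [/existsP//|/existsPn lm] := boolP [exists j, (b ^ m <= l j)%N].
  have lt_l j : (l j < b ^ m)%N by rewrite ltnNge lm.
  case/negP: lr; apply/mapP; exists [ffun j => Ordinal (lt_l j)].
    by rewrite mem_enum.
  by apply/ffunP => j; rewrite !ffunE.
rewrite (mix_density_walsh b_prime _ (N := m) _ cz); last by move=> p j; exact: gm.
(* The zero vector as a bounded index: its term is the leading 1, and the other terms make up S. *)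
pose f0 : {ffun 'I_s -> 'I_(b ^ m)} := [ffun=> Ordinal (ltnW n_gt1)].
have f0E : vec_of f0 = zvec by apply/ffunP => j; rewrite !ffunE.
rewrite (bigD1 f0)//= -/pair_coef f0E pair_coef0 !wal_0 conjc1 !mulr1; congr (_ + _).
rewrite big_map big_enum_cond/=; apply: eq_bigl => f.
by rewrite -f0E (inj_eq (@vec_of_inj _ _)).
Qed.

End PairDensity.

(** * Walsh decomposition of the joint density *)

Theorem proposition9 (R : realType) (d : measure_display)
    (Omega : measurableType d) (P : probability Omega R)
    (b s m t : nat) (b_prime : prime b) (s_ge1 : (1 <= s)%N)
    (m_ge1 : (1 <= m)%N) (t_le_m : (t <= m)%N)
    (V : 'I_(b ^ m) -> s.-tuple R) (V_net : is_net b t m V)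
    (V_proj : forall j : 'I_s, is_net b 0 m (projection j V))
    (U : 'I_(b ^ m) -> {RV P >-> s.-tuple R}) (VU : scrambling b V U)
    (I J : Omega -> 'I_(b ^ m)) (IJ : random_distinct_pair U I J)
    (psi : s.-tuple R * s.-tuple R -> R) (psi_pdf : joint_pdf U I J psi) :
  let n : R := (b ^ m)%:R in
  let psihat (l : vec s) : R[i] := walsh_coef b psi l l in
  [/\ walsh_coef b psi zvec zvec = 1,
      forall l l' : vec s, l != l' -> walsh_coef b psi l l' = 0 &
      {ae lebcube2 R s, forall z, exists2 S : R[i],
         has_sum (fun l : vec s => l != zvec)
           (fun l => psihat l * wal b l z.1 * conjc (wal b l z.2)) S &
         (psi z)%:C%C = 1 + S}]
  /\
  (forall l : vec s, l != zvec ->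
   let r := supp l in
   let k := digit_lengths b l in
   {ae P, forall w, psihat l =
     ((n * (n - 1))^-1 * (b%:R / (b%:R - 1)) ^+ bsum r *
      \sum_(e : bvec s | le_bvec e r)
        (-1) ^+ bsum e * b%:R ^- bsum e *
        (Mcount b (sub_vec k e) (fun i => U i w))%:R)%:C%C}).
Proof.
move=> n psihat.
have m_psi : measurable_fun [set: s.-tuple R * s.-tuple R] psi by case: psi_pdf.
have psi_ae := pair_density_ae b_prime m_ge1 V_proj VU IJ psi_pdf.
have coefE l l' : walsh_coef b psi l l' = (l == l')%:R * (pair_coef V l)%:C%C.
  rewrite (walsh_coef_ae b_prime _ _ m_psi _ psi_ae) ?walsh_coef_mix//.
  exact: measurable_mix_density.
have psihatE l : psihat l = (pair_coef V l)%:C%C by rewrite /psihat coefE eqxx mul1r.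
split; first split.
- by rewrite coefE eqxx mul1r pair_coef0.
- by move=> l l' /negPf ll'; rewrite coefE ll' mul0r.
(* The expansion is exact at every point of the cube where [psi] equals the explicit density. *)
- apply: filterS2 psi_ae (ae_cube2 R s) => z -> cz.
  have [S sumS psiS] := pair_density_has_sum b_prime m_ge1 V_proj cz.
  exists S => //.
  have -> // : (fun l => psihat l * wal b l z.1 * conjc (wal b l z.2)) =
    (fun l => (pair_coef V l)%:C%C * wal b l z.1 * conjc (wal b l z.2)).
  by apply/funext => l; rewrite psihatE.
- move=> l _ r k; apply: filterS (ae_pair_gamma b_prime V_proj VU) => w Dw.
  by rewrite psihatE; congr (_%:C)%C; exact: pair_coefE.
Qed.
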